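(* ($\mathbf{ZF}$) The following conditions are all equivalent: (i) $\mathbf{CAC}_{fin}$; (ii) every totally bounded scattered metric space is countable; (iii) every compact metrizable scattered space is countable; (iv) every totally bounded, complete scattered metric space is compact.
   Context: The theorem is in $\mathbf{ZF}$ (no axiom of choice). $\mathbf{CAC}_{fin}$: every denumerable (countably infinite) family of non-empty finite sets has a choice function. A topological space is scattered if every non-empty subspace has an isolated point; for metric spaces this refers to the induced topology. A metric space is totally bounded if for every $\varepsilon>0$ it is covered by finitely many balls of radius $\varepsilon$; complete if every Cauchy sequence converges. Compact means every open cover has a finite subcover. *)

(* Defs.v *)
(* "Provable in ZF" is rendered as "true in every first-order model of ZF".
   Stating the conditions directly about Rocq types would be meaningless, since
   the usual classical axioms already give the axiom of choice for them.  For
   the same reason separation and replacement are schemas over syntactic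
   first-order formulas with parameters: over arbitrary predicates, choice in
   the metatheory would give choice in the model.  All the mathematical notions
   below (finite, compact, sequence and so on) are internal to the model: they
   quantify over its elements only, and are built from membership and
   equality. *)

Record membership_structure := MembershipStructure {
  dom :> Type;
  elem : dom -> dom -> Prop
}.

Arguments elem {_} _ _.

Declare Scope zf_scope.
Open Scope zf_scope.
Notation "x ∈ y" := (elem x y) (at level 70, no associativity) : zf_scope.

(* Variables are de Bruijn indices: [FAll] binds index 0. *)

Inductive formula : Type :=
| FMem (i j : nat)
| FEq (i j : nat)
| FBot
| FImp (p q : formula)
| FAll (p : formula).

Definition scons {A : Type} (x : A) (e : nat -> A) : nat -> A :=
  fun i => match i with O => x | S j => e j end.

Fixpoint sat (V : membership_structure) (e : nat -> V) (p : formula) : Prop :=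
  match p with
  | FMem i j => e i ∈ e j
  | FEq i j => e i = e j
  | FBot => False
  | FImp p q => sat V e p -> sat V e q
  | FAll p => forall x : V, sat V (scons x e) p
  end.

Definition subset {V : membership_structure} (A B : V) : Prop :=
  forall x, x ∈ A -> x ∈ B.

Definition is_empty {V : membership_structure} (A : V) : Prop :=
  forall x, ~ x ∈ A.

Definition nonempty {V : membership_structure} (A : V) : Prop :=
  exists x, x ∈ A.

Definition is_upair {V : membership_structure} (u a b : V) : Prop :=
  forall x, x ∈ u <-> x = a \/ x = b.

Definition is_union {V : membership_structure} (U A : V) : Prop :=
  forall x, x ∈ U <-> exists y, y ∈ A /\ x ∈ y.

Definition is_inter {V : membership_structure} (C A B : V) : Prop :=
  forall x, x ∈ C <-> x ∈ A /\ x ∈ B.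

Definition is_succ {V : membership_structure} (s n : V) : Prop :=
  forall x, x ∈ s <-> x ∈ n \/ x = n.

Definition inductive_set {V : membership_structure} (I : V) : Prop :=
  (exists z, is_empty z /\ z ∈ I) /\
  (forall n, n ∈ I -> exists s, is_succ s n /\ s ∈ I).

Record ZF (V : membership_structure) : Prop := {
  zf_extensionality : forall A B : V, (forall x, x ∈ A <-> x ∈ B) -> A = B;
  zf_foundation : forall A : V, nonempty A ->
    exists x, x ∈ A /\ forall y, y ∈ x -> ~ y ∈ A;
  zf_pairing : forall a b : V, exists u, is_upair u a b;
  zf_union : forall A : V, exists U, is_union U A;
  zf_powerset : forall A : V, exists P, forall x, x ∈ P <-> subset x A;
  zf_infinity : exists I : V, inductive_set I;
  zf_separation : forall (p : formula) (e : nat -> V) (A : V),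
    exists B, forall x, x ∈ B <-> x ∈ A /\ sat V (scons x e) p;
  (* index 0 is the argument, index 1 the value, the rest are parameters *)
  zf_replacement : forall (p : formula) (e : nat -> V) (A : V),
    (forall x y y', x ∈ A -> sat V (scons x (scons y e)) p ->
       sat V (scons x (scons y' e)) p -> y = y') ->
    exists B, forall y, y ∈ B <->
      exists x, x ∈ A /\ sat V (scons x (scons y e)) p
}.

(* Kuratowski pairs; functions and relations are sets of pairs. *)

Definition is_pair {V : membership_structure} (p a b : V) : Prop :=
  exists s t, is_upair s a a /\ is_upair t a b /\ is_upair p s t.

Definition is_prod {V : membership_structure} (P A B : V) : Prop :=
  forall p, p ∈ P <-> exists a b, a ∈ A /\ b ∈ B /\ is_pair p a b.

(* [(a, b) ∈ r]; for a function [r] this reads [r(a) = b]. *)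
Definition rel {V : membership_structure} (r a b : V) : Prop :=
  exists p, is_pair p a b /\ p ∈ r.

(* [f(a, b) = c] *)
Definition rel2 {V : membership_structure} (f a b c : V) : Prop :=
  exists p, is_pair p a b /\ rel f p c.

Definition is_fun {V : membership_structure} (f A B : V) : Prop :=
  (forall p, p ∈ f -> exists a b, a ∈ A /\ b ∈ B /\ is_pair p a b) /\
  (forall a, a ∈ A -> exists! b, rel f a b).

Definition is_fun2 {V : membership_structure} (f A B C : V) : Prop :=
  exists P, is_prod P A B /\ is_fun f P C.

Definition is_injection {V : membership_structure} (f A B : V) : Prop :=
  is_fun f A B /\ (forall a a' b, rel f a b -> rel f a' b -> a = a').

Definition is_bijection {V : membership_structure} (f A B : V) : Prop :=
  is_injection f A B /\ (forall b, b ∈ B -> exists a, rel f a b).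

(* Natural numbers are the von Neumann ones, so that [n = {0, ..., n-1}] and
   [m < n] is [m ∈ n]. *)

Definition is_nat {V : membership_structure} (n : V) : Prop :=
  forall I : V, inductive_set I -> n ∈ I.

Definition is_omega {V : membership_structure} (w : V) : Prop :=
  forall n, n ∈ w <-> is_nat n.

Definition nat_le {V : membership_structure} (m n : V) : Prop :=
  m ∈ n \/ m = n.

Definition finite {V : membership_structure} (A : V) : Prop :=
  exists n f, is_nat n /\ is_bijection f n A.

Definition denumerable {V : membership_structure} (A : V) : Prop :=
  exists w f, is_omega w /\ is_bijection f w A.

Definition countable {V : membership_structure} (A : V) : Prop :=
  finite A \/ denumerable A.

Definition choice_function {V : membership_structure} (f A : V) : Prop :=
  exists U, is_union U A /\ is_fun f A U /\
    forall x y, rel f x y -> y ∈ x.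

Definition CAC_fin (V : membership_structure) : Prop :=
  forall A : V, denumerable A ->
    (forall x, x ∈ A -> nonempty x /\ finite x) ->
    exists f, choice_function f A.

Definition topology {V : membership_structure} (X T : V) : Prop :=
  (forall U, U ∈ T -> subset U X) /\
  X ∈ T /\
  (forall C U, subset C T -> is_union U C -> U ∈ T) /\
  (forall A B C, A ∈ T -> B ∈ T -> is_inter C A B -> C ∈ T).

Definition open_cover {V : membership_structure} (X T C : V) : Prop :=
  subset C T /\ forall x, x ∈ X -> exists U, U ∈ C /\ x ∈ U.

Definition compact {V : membership_structure} (X T : V) : Prop :=
  forall C, open_cover X T C ->
    exists D, subset D C /\ finite D /\ open_cover X T D.

Definition isolated {V : membership_structure} (T S x : V) : Prop :=
  x ∈ S /\ exists U, U ∈ T /\ forall y, y ∈ U /\ y ∈ S <-> y = x.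

Definition scattered {V : membership_structure} (X T : V) : Prop :=
  forall S, subset S X -> nonempty S -> exists x, isolated T S x.

(* The real line of the model is given by its characterization, unique up to
   isomorphism: a Dedekind-complete ordered field.  All the components are
   elements of the model, so that completeness concerns only those sets of reals
   which belong to the model. *)

Record field_structure (V : membership_structure) := FieldStructure {
  carrier : V;
  zero : V;
  one : V;
  add : V;
  mul : V;
  le : V
}.

Arguments carrier {V} _.
Arguments zero {V} _.
Arguments one {V} _.
Arguments add {V} _.
Arguments mul {V} _.
Arguments le {V} _.

Record ordered_field {V : membership_structure} (R : field_structure V) : Prop := {
  of_zero : zero R ∈ carrier R;
  of_one : one R ∈ carrier R;
  of_add : is_fun2 (add R) (carrier R) (carrier R) (carrier R);
  of_mul : is_fun2 (mul R) (carrier R) (carrier R) (carrier R);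
  of_addA : forall x y z xy yz s, rel2 (add R) x y xy -> rel2 (add R) y z yz ->
    rel2 (add R) xy z s -> rel2 (add R) x yz s;
  of_addC : forall x y s, rel2 (add R) x y s -> rel2 (add R) y x s;
  of_add0 : forall x, x ∈ carrier R -> rel2 (add R) x (zero R) x;
  of_opp : forall x, x ∈ carrier R ->
    exists y, y ∈ carrier R /\ rel2 (add R) x y (zero R);
  of_mulA : forall x y z xy yz s, rel2 (mul R) x y xy -> rel2 (mul R) y z yz ->
    rel2 (mul R) xy z s -> rel2 (mul R) x yz s;
  of_mulC : forall x y s, rel2 (mul R) x y s -> rel2 (mul R) y x s;
  of_mul1 : forall x, x ∈ carrier R -> rel2 (mul R) x (one R) x;
  of_inv : forall x, x ∈ carrier R -> x <> zero R ->
    exists y, y ∈ carrier R /\ rel2 (mul R) x y (one R);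
  of_mulD : forall x y z yz xy xz s, rel2 (add R) y z yz ->
    rel2 (mul R) x y xy -> rel2 (mul R) x z xz ->
    rel2 (mul R) x yz s -> rel2 (add R) xy xz s;
  of_zero_neq_one : zero R <> one R;
  of_le_refl : forall x, x ∈ carrier R -> rel (le R) x x;
  of_le_antisym : forall x y, x ∈ carrier R -> y ∈ carrier R ->
    rel (le R) x y -> rel (le R) y x -> x = y;
  of_le_trans : forall x y z,
    x ∈ carrier R -> y ∈ carrier R -> z ∈ carrier R ->
    rel (le R) x y -> rel (le R) y z -> rel (le R) x z;
  of_le_total : forall x y, x ∈ carrier R -> y ∈ carrier R ->
    rel (le R) x y \/ rel (le R) y x;
  of_le_add : forall x y z xz yz, x ∈ carrier R -> y ∈ carrier R ->
    rel (le R) x y ->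
    rel2 (add R) x z xz -> rel2 (add R) y z yz -> rel (le R) xz yz;
  of_le_mul : forall x y xy, rel (le R) (zero R) x -> rel (le R) (zero R) y ->
    rel2 (mul R) x y xy -> rel (le R) (zero R) xy
}.

Definition upper_bound {V : membership_structure} (R : field_structure V)
    (S b : V) : Prop :=
  b ∈ carrier R /\ forall x, x ∈ S -> rel (le R) x b.

Definition is_real_field {V : membership_structure} (R : field_structure V) : Prop :=
  ordered_field R /\
  forall S, subset S (carrier R) -> nonempty S ->
    (exists b, upper_bound R S b) ->
    exists b, upper_bound R S b /\
      forall c, upper_bound R S c -> rel (le R) b c.

Definition lt {V : membership_structure} (R : field_structure V) (x y : V) : Prop :=
  rel (le R) x y /\ x <> y.

Definition positive {V : membership_structure} (R : field_structure V) (e : V) : Prop :=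
  e ∈ carrier R /\ lt R (zero R) e.

Definition metric {V : membership_structure} (R : field_structure V)
    (X d : V) : Prop :=
  is_fun2 d X X (carrier R) /\
  (forall x y r, rel2 d x y r -> rel (le R) (zero R) r) /\
  (forall x y, x ∈ X -> y ∈ X -> (rel2 d x y (zero R) <-> x = y)) /\
  (forall x y r, rel2 d x y r -> rel2 d y x r) /\
  (forall x y z a b c s, rel2 d x y a -> rel2 d y z b -> rel2 d x z c ->
     rel2 (add R) a b s -> rel (le R) c s).

(* [d(x, y) < e] *)
Definition closer {V : membership_structure} (R : field_structure V)
    (d x y e : V) : Prop :=
  exists r, rel2 d x y r /\ lt R r e.

Definition is_ball {V : membership_structure} (R : field_structure V)
    (X d B x e : V) : Prop :=
  forall y, y ∈ B <-> y ∈ X /\ closer R d x y e.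

Definition metric_topology {V : membership_structure} (R : field_structure V)
    (X d T : V) : Prop :=
  forall U, U ∈ T <-> subset U X /\
    forall x, x ∈ U -> exists e B,
      positive R e /\ is_ball R X d B x e /\ subset B U.

Definition metrizable {V : membership_structure} (R : field_structure V)
    (X T : V) : Prop :=
  exists d, metric R X d /\ metric_topology R X d T.

Definition totally_bounded {V : membership_structure} (R : field_structure V)
    (X d : V) : Prop :=
  forall e, positive R e ->
    exists F, subset F X /\ finite F /\
      forall y, y ∈ X -> exists x B, x ∈ F /\ is_ball R X d B x e /\ y ∈ B.

Definition is_seq {V : membership_structure} (X s : V) : Prop :=
  exists w, is_omega w /\ is_fun s w X.

Definition cauchy {V : membership_structure} (R : field_structure V)
    (d s : V) : Prop :=
  forall e, positive R e -> exists N, is_nat N /\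
    forall m n x y, nat_le N m -> nat_le N n -> rel s m x -> rel s n y ->
      closer R d x y e.

Definition converges {V : membership_structure} (R : field_structure V)
    (d s l : V) : Prop :=
  forall e, positive R e -> exists N, is_nat N /\
    forall n x, nat_le N n -> rel s n x -> closer R d x l e.

Definition complete {V : membership_structure} (R : field_structure V)
    (X d : V) : Prop :=
  forall s, is_seq X s -> cauchy R d s ->
    exists l, l ∈ X /\ converges R d s l.

(* Main.v *)
(** (i) => (ii).  Let [X] be totally bounded and scattered.  Removing isolated
   points again and again, with intersections at limit stages, produces a chain
   of subsets of [X]; let [c x] be its least member containing [x].  Since [X] is
   scattered, [x] is isolated in [c x], so some ball of radius [2^-n] around [x]
   meets [c x] only in [x]; let [nu x] be the least such [n].  If
   [nu x = nu y = n] and [x <> y], then, say, [c x] contains [c y], hence [y],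
   and therefore [d(x, y) >= 2^-n].  So the fibres of [nu] are separated, hence
   finite, and [X] is a countable union of finite sets; countable choice for the
   finite sets of linear orders on the fibres enumerates it.

   (i) => (iv).  [X] is countable by (ii), so the classical proof that complete
   and totally bounded implies compact needs no choice: all points are picked
   along an enumeration.

   (iii) => (i) and (iv) => (i).  Given finite non-empty sets [A_0, A_1, ...], let
   [Z] be the set of finite partial choice functions and put
   [d(g, h) = max(2^-len g, 2^-len h)] for [g <> h].  This is totally bounded and
   discrete.  With a point at infinity it is compact and scattered, so that (iii)
   enumerates [Z].  Without it, [Z] is not compact, so that (iv) provides a
   Cauchy sequence without limit.  Either way there is a sequence of arbitrarily
   long partial choices. *)

From Stdlib Require Import ClassicalEpsilon List ssreflect.
Require Import Defs.

Set Implicit Arguments.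
Unset Strict Implicit.
Unset Printing Implicit Defensive.

Existing Class ZF.
Existing Class is_real_field.

(** * Definability *)

Section Formulas.

Context {V : membership_structure}.

(** Formulas in which elements of the model occur as constants. Parameters can then be used without
    numbering them; they are turned into free variables only when [compile] produces an official
    formula. *)
Inductive term_code := Var (i : nat) | Cst (c : V).

Inductive code :=
| CMem (s t : term_code)
| CEq (s t : term_code)
| CBot
| CImp (p q : code)
| CAll (p : code).

Definition tval (a : nat -> V) (t : term_code) : V :=
  match t with Var i => a i | Cst c => c end.

Fixpoint csat (a : nat -> V) (p : code) : Prop :=
  match p with
  | CMem s t => tval a s ∈ tval a t
  | CEq s t => tval a s = tval a t
  | CBot => False
  | CImp p q => csat a p -> csat a q
  | CAll p => forall x, csat (scons x a) p
  end.

Definition tconsts (t : term_code) : list V :=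
  match t with Var _ => nil | Cst c => c :: nil end.

Fixpoint consts (p : code) : list V :=
  match p with
  | CMem s t | CEq s t => tconsts s ++ tconsts t
  | CBot => nil
  | CImp p q => consts p ++ consts q
  | CAll p => consts p
  end.

(* Under [k] binders, the constant [c] is read at position [k + pos c]. *)
Definition tcompile (pos : V -> nat) (k : nat) (t : term_code) : nat :=
  match t with Var i => i | Cst c => k + pos c end.

Fixpoint compile (pos : V -> nat) (k : nat) (p : code) : formula :=
  match p with
  | CMem s t => FMem (tcompile pos k s) (tcompile pos k t)
  | CEq s t => FEq (tcompile pos k s) (tcompile pos k t)
  | CBot => FBot
  | CImp p q => FImp (compile pos k p) (compile pos k q)
  | CAll p => FAll (compile pos (S k) p)
  end.

Lemma tcompile_val (pos : V -> nat) (e : nat -> V) k t (a : nat -> V) :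
  (forall i, a (k + i) = e i) -> (forall c, In c (tconsts t) -> e (pos c) = c) ->
  a (tcompile pos k t) = tval a t.
Proof.
case: t => [i|c] //= Ha He.
by rewrite Ha He //; left.
Qed.

Lemma compile_sat (pos : V -> nat) (e : nat -> V) p : forall k (a : nat -> V),
  (forall i, a (k + i) = e i) -> (forall c, In c (consts p) -> e (pos c) = c) ->
  sat V a (compile pos k p) <-> csat a p.
Proof.
elim: p => [s t|s t||p IHp q IHq|p IHp] k a Ha He /=.
1,2: by rewrite !(@tcompile_val pos e) // => c Hc; apply: He; apply: in_or_app; auto.
- by [].
- rewrite IHp // ?IHq // => c Hc; apply: He; apply: in_or_app; auto.
- by split=> H x; apply/(IHp (S k) (scons x a) Ha He).
Qed.

(** A formula contains finitely many constants, so a single environment listing them supplies all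
    its parameters; [pos] sends a constant to some place where it is listed. *)
Lemma consts_env (x0 : V) (l : list V) :
  exists (pos : V -> nat) (e : nat -> V), forall c, In c l -> e (pos c) = c.
Proof.
exists (fun c => epsilon (inhabits 0) (fun i => nth i l x0 = c)), (fun i => nth i l x0).
move=> c Hc.
apply: (epsilon_spec (inhabits 0) (fun i => nth i l x0 = c)).
by have [i [_ Hi]] := In_nth l c x0 Hc; exists i.
Qed.

(* [D P]: the predicate [P] on environments is first-order definable with
   parameters; [DT t]: so is the graph of the operation [t]. *)
Definition D (P : (nat -> V) -> Prop) : Prop :=
  exists p, forall a, csat a p <-> P a.

Definition DT (t : (nat -> V) -> V) : Prop := D (fun a => a 0 = t (fun i => a (S i))).

(** The versions of fixed arity are classes, so that instance search finds the definability of named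
    predicates and operations. *)
Class D1 (P : V -> Prop) : Prop := d1 : D (fun a => P (a 0)).
Class D2 (P : V -> V -> Prop) : Prop := d2 : D (fun a => P (a 0) (a 1)).
Class D3 (P : V -> V -> V -> Prop) : Prop := d3 : D (fun a => P (a 0) (a 1) (a 2)).
Class D4 (P : V -> V -> V -> V -> Prop) : Prop :=
  d4 : D (fun a => P (a 0) (a 1) (a 2) (a 3)).
Class F1 (f : V -> V) : Prop := f1 : DT (fun a => f (a 0)).
Class F2 (f : V -> V -> V) : Prop := f2 : DT (fun a => f (a 0) (a 1)).
Class F3 (f : V -> V -> V -> V) : Prop := f3 : DT (fun a => f (a 0) (a 1) (a 2)).

Lemma separation {HV : ZF V} (P : V -> Prop) : D1 P ->
  forall A, exists B, forall x, x ∈ B <-> x ∈ A /\ P x.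
Proof.
move=> [p Hp] A.
have [pos [e He]] := consts_env A (consts p).
(* Compilation starts at depth 1, because index 0 is taken by the element being tested. *)
have [B HB] := zf_separation V HV (compile pos 1 p) e A.
exists B => x; rewrite HB (@compile_sat pos e) //.
by rewrite Hp.
Qed.

(** A proposition that does not depend on the environment is classically equivalent to true or to
    false, whatever it says, and both have a formula. *)
Lemma D_const (P : Prop) : D (fun _ => P).
Proof.
case: (classic P) => H; last by exists CBot => a /=; tauto.
by exists (CImp CBot CBot) => a /=; tauto.
Qed.

Lemma D_imp P Q : D P -> D Q -> D (fun a => P a -> Q a).
Proof. by move=> [p Hp] [q Hq]; exists (CImp p q) => a /=; rewrite Hp Hq. Qed.

Lemma D_iff_ext P Q : (forall a, P a <-> Q a) -> D P -> D Q.
Proof. by move=> H [p Hp]; exists p => a; rewrite Hp. Qed.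

Lemma D_not P : D P -> D (fun a => ~ P a).
Proof. move=> H; exact: D_imp H (D_const False). Qed.

Lemma D_and P Q : D P -> D Q -> D (fun a => P a /\ Q a).
Proof.
move=> HP HQ; apply: (@D_iff_ext (fun a => ~ (P a -> ~ Q a))); first by move=> a; tauto.
by apply: D_not; apply: D_imp => //; apply: D_not.
Qed.

Lemma D_or P Q : D P -> D Q -> D (fun a => P a \/ Q a).
Proof.
move=> HP HQ; apply: (@D_iff_ext (fun a => ~ P a -> Q a)); first by move=> a; tauto.
by apply: D_imp => //; apply: D_not.
Qed.

Lemma D_iff P Q : D P -> D Q -> D (fun a => P a <-> Q a).
Proof. by move=> HP HQ; apply: D_and; apply: D_imp. Qed.

Lemma D_all (P : (nat -> V) -> V -> Prop) :
  D (fun a => P (fun i => a (S i)) (a 0)) -> D (fun a => forall x, P a x).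
Proof.
move=> [p Hp]; exists (CAll p) => a /=.
by split=> H x; [apply/(Hp (scons x a))|apply/(Hp (scons x a)); apply: H].
Qed.

Lemma D_ex (P : (nat -> V) -> V -> Prop) :
  D (fun a => P (fun i => a (S i)) (a 0)) -> D (fun a => exists x, P a x).
Proof.
move=> HP; apply: (@D_iff_ext (fun a => ~ forall x, ~ P a x)).
  move=> a; split; last by move=> [x Hx] H; exact: H Hx.
  by move=> H; apply: NNPP => H'; apply: H => x Hx; apply: H'; exists x.
apply: D_not; apply: (@D_all (fun a x => ~ P a x)); exact: D_not.
Qed.

Lemma D_exu (P : (nat -> V) -> V -> Prop) :
  D (fun a => exists x, P a x /\ forall y, P a y -> x = y) -> D (fun a => exists! x, P a x).
Proof. by []. Qed.

Definition tren (f : nat -> nat) (t : term_code) : term_code :=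
  match t with Var i => Var (f i) | Cst c => Cst c end.

Definition up (f : nat -> nat) (i : nat) : nat :=
  match i with O => O | S j => S (f j) end.

Fixpoint cren (f : nat -> nat) (p : code) : code :=
  match p with
  | CMem s t => CMem (tren f s) (tren f t)
  | CEq s t => CEq (tren f s) (tren f t)
  | CBot => CBot
  | CImp p q => CImp (cren f p) (cren f q)
  | CAll p => CAll (cren (up f) p)
  end.

Lemma csat_ren p : forall f (a b : nat -> V), (forall i, b i = a (f i)) ->
  csat a (cren f p) <-> csat b p.
Proof.
have Ht f (a b : nat -> V) t : (forall i, b i = a (f i)) -> tval a (tren f t) = tval b t.
  by case: t => //= i Hi; rewrite Hi.
elim: p => [s t|s t||p IHp q IHq|p IHp] f a b Hab /=.
1,2: by rewrite !(Ht f a b).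
- by [].
- by rewrite (IHp f a b) ?(IHq f a b).
- by split=> H x; move: (H x); apply IHp; case.
Qed.

Lemma D_ren P f : D P -> D (fun a => P (fun i => a (f i))).
Proof.
move=> [p Hp]; exists (cren f p) => a.
by rewrite (@csat_ren p f a (fun i => a (f i))).
Qed.

Lemma DT_var i : DT (fun a => a i).
Proof. by exists (CEq (Var 0) (Var (S i))). Qed.

Lemma DT_const c : DT (fun _ => c).
Proof. by exists (CEq (Var 0) (Cst c)). Qed.

Lemma DT_weaken t : DT t -> DT (fun a => t (fun i => a (S i))).
Proof. move=> H; exact: (D_ren (up S) H). Qed.

(** The language has no function symbols, so a term is eliminated by naming its value: there is an
    [x] with [x = t a] and [P a x]. Operations with a definable graph can therefore be nested
    freely. *)
Lemma D_subst (P : (nat -> V) -> V -> Prop) t :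
  D (fun a => P (fun i => a (S i)) (a 0)) -> DT t -> D (fun a => P a (t a)).
Proof.
move=> HP Ht; apply: (@D_iff_ext (fun a => exists x, x = t a /\ P a x)).
  move=> a; split; first by move=> [x [-> Hx]].
  by exists (t a).
by apply: (@D_ex (fun a x => x = t a /\ P a x)); apply: D_and.
Qed.

Lemma D_app1 (P : V -> Prop) t : D1 P -> DT t -> D (fun a => P (t a)).
Proof.
by move=> HP Ht; apply: (@D_subst (fun _ => P)).
Qed.

Lemma D_app2 (P : V -> V -> Prop) t u :
  D2 P -> DT t -> DT u -> D (fun a => P (t a) (u a)).
Proof.
move=> HP Ht Hu; apply: (@D_subst (fun a x => P x (u a)) t) => //.
apply: (@D_subst (fun a y => P (a 0) y) (fun a => u (fun i => a (S i)))); last exact: DT_weaken.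
(* Arguments are substituted one at a time, each new one at index 0, so they end up in reverse order
   and the variables of [P] are permuted accordingly. *)
exact: (D_ren (fun i => match i with O => 1 | _ => 0 end) HP).
Qed.

Lemma D_app3 (P : V -> V -> V -> Prop) t u v :
  D3 P -> DT t -> DT u -> DT v -> D (fun a => P (t a) (u a) (v a)).
Proof.
move=> HP Ht Hu Hv; apply: (@D_subst (fun a x => P x (u a) (v a)) t) => //.
apply: (@D_subst (fun a y => P (a 0) y (v (fun i => a (S i)))) (fun a => u (fun i => a (S i))));
  last exact: DT_weaken.
apply: (@D_subst (fun a z => P (a 1) (a 0) z)
  (fun a => v (fun i => a (S (S i))))); last exact: (DT_weaken (DT_weaken Hv)).
exact: (D_ren (fun i => match i with O => 2 | 1 => 1 | _ => 0 end) HP).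
Qed.

Lemma D_app4 (P : V -> V -> V -> V -> Prop) t u v w :
  D4 P -> DT t -> DT u -> DT v -> DT w -> D (fun a => P (t a) (u a) (v a) (w a)).
Proof.
move=> HP Ht Hu Hv Hw; apply: (@D_subst (fun a x => P x (u a) (v a) (w a)) t) => //.
apply: (@D_subst (fun a y => P (a 0) y (v (fun i => a (S i))) (w (fun i => a (S i))))
  (fun a => u (fun i => a (S i)))); last exact: DT_weaken.
apply: (@D_subst (fun a z => P (a 1) (a 0) z (w (fun i => a (S (S i)))))
  (fun a => v (fun i => a (S (S i))))); last exact: (DT_weaken (DT_weaken Hv)).
apply: (@D_subst (fun a z => P (a 2) (a 1) (a 0) z)
  (fun a => w (fun i => a (S (S (S i))))));
  last exact: (DT_weaken (DT_weaken (DT_weaken Hw))).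
exact: (D_ren (fun i => match i with O => 3 | 1 => 2 | 2 => 1 | _ => 0 end) HP).
Qed.

Lemma D_mem t u : DT t -> DT u -> D (fun a => t a ∈ u a).
Proof. by apply: D_app2; exists (CMem (Var 0) (Var 1)). Qed.

Lemma D_eq t u : DT t -> DT u -> D (fun a => t a = u a).
Proof. by apply: (D_app2 (P := eq)); exists (CEq (Var 0) (Var 1)). Qed.

Lemma DT_app1 f t : F1 f -> DT t -> DT (fun a => f (t a)).
Proof.
move=> Hf Ht; apply: (D_app2 (P := fun y x => y = f x)) => //.
- exact: (DT_var 0).
- exact: DT_weaken.
Qed.

Lemma DT_app2 f t u : F2 f -> DT t -> DT u -> DT (fun a => f (t a) (u a)).
Proof.
move=> Hf Ht Hu; apply: (D_app3 (P := fun z x y => z = f x y)) => //.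
- exact: (DT_var 0).
- exact: DT_weaken.
- exact: DT_weaken.
Qed.

Lemma DT_app3 f t u v : F3 f -> DT t -> DT u -> DT v -> DT (fun a => f (t a) (u a) (v a)).
Proof.
move=> Hf Ht Hu Hv; apply: (D_app4 (P := fun z x y w => z = f x y w)) => //.
- exact: (DT_var 0).
- exact: DT_weaken.
- exact: DT_weaken.
- exact: DT_weaken.
Qed.

End Formulas.

(** * Definite descriptions and definable operations *)

Section Description.

Context {V : membership_structure} {HV : ZF V}.

Lemma dom_inhabited : inhabited V.
Proof. by have [I _] := zf_infinity V HV. Qed.

Lemma empty_exists : exists z : V, is_empty z.
Proof. by have [I [[z [Hz _]] _]] := zf_infinity V HV; exists z. Qed.

Lemma ext_eq (A B : V) : (forall x, x ∈ A <-> x ∈ B) -> A = B.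
Proof. exact: (zf_extensionality V HV). Qed.

(* Definite description, with the empty set as value when the description is
   not satisfied exactly once: this convention makes the operation definable. *)
Definition the (P : V -> Prop) : V :=
  epsilon dom_inhabited (fun y => (P y /\ forall z, P z -> z = y) \/
    (~ (exists y, P y /\ forall z, P z -> z = y)) /\ forall x, ~ x ∈ y).

Lemma the_prop (P : V -> Prop) : (P (the P) /\ forall z, P z -> z = the P) \/
    (~ (exists y, P y /\ forall z, P z -> z = y)) /\ forall x, ~ x ∈ the P.
Proof.
apply: (epsilon_spec dom_inhabited (fun y => (P y /\ forall z, P z -> z = y) \/
    (~ (exists y, P y /\ forall z, P z -> z = y)) /\ forall x, ~ x ∈ y)).
case: (classic (exists y, P y /\ forall z, P z -> z = y)) => [[y Hy]|H]; first by exists y; left.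
by have [z Hz] := empty_exists; exists z; right.
Qed.

Lemma the_eq (P : V -> Prop) y : P y -> (forall z, P z -> z = y) -> the P = y.
Proof.
move=> Hy Hu; have [[Ht _]|[[]]] := the_prop P; first exact: Hu.
by exists y.
Qed.

(** The right-hand side mentions only [P] and membership, not the [epsilon] behind [the]; this is
    what makes the operation definable in [DT_the]. *)
Lemma the_graph (P : V -> Prop) y : y = the P <-> (P y /\ forall z, P z -> z = y) \/
  (~ exists y, P y /\ forall z, P z -> z = y) /\ forall x, ~ x ∈ y.
Proof.
split; first by move=> ->; exact: the_prop.
case=> [[H1 H2]|[H1 H2]]; first by symmetry; apply: the_eq.
have [[H3 H4]|[H3 H4]] := the_prop P; first by case: H1; exists (the P).
by apply: ext_eq => x; split=> Hx; [case: (H2 x)|case: (H4 x)].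
Qed.

Lemma the_sat (P : V -> Prop) : (exists y, P y) ->
  (forall y z, P y -> P z -> y = z) -> P (the P).
Proof. by move=> [y Hy] Hu; rewrite (@the_eq P y) // => z Hz; apply: Hu. Qed.

Lemma DT_the (P : (nat -> V) -> V -> Prop) :
  D (fun a => P (fun i => a (S i)) (a 0)) -> DT (fun a => the (P a)).
Proof.
move=> HP.
pose Q := fun (a : nat -> V) y => P a y /\ forall z, P a z -> z = y.
have HQ : D (fun a => Q (fun i => a (S i)) (a 0)).
  apply: D_and => //; apply: (@D_all _ (fun a z => P (fun i => a (S i)) z -> z = a 0)).
  apply: D_imp; last by apply: D_eq; apply: DT_var.
  exact: (D_ren (up S) HP).
apply: (@D_iff_ext _ (fun a => Q (fun i => a (S i)) (a 0) \/
   (~ exists y, Q (fun i => a (S i)) y) /\ forall x, ~ x ∈ a 0)).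
  by move=> a; rewrite the_graph.
apply: D_or => //; apply: D_and.
- apply: D_not; apply: (@D_ex _ (fun a y => Q (fun i => a (S i)) y)).
  exact: (D_ren (up S) HQ).
- apply: (@D_all _ (fun a x => ~ x ∈ a 0)); apply: D_not; apply: D_mem; exact: DT_var.
Qed.

Definition sep (A : V) (P : V -> Prop) : V := the (fun B => forall x, x ∈ B <-> x ∈ A /\ P x).

Lemma in_sep (A : V) (P : V -> Prop) {HP : D1 P} x : x ∈ sep A P <-> x ∈ A /\ P x.
Proof.
move: x; apply: (the_sat (P := fun B => forall x, x ∈ B <-> x ∈ A /\ P x)).
  exact: separation.
by move=> B C HB HC; apply: ext_eq => x; rewrite HB HC.
Qed.

Lemma DT_sep (t : (nat -> V) -> V) (P : (nat -> V) -> V -> Prop) :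
  DT t -> D (fun a => P (fun i => a (S i)) (a 0)) -> DT (fun a => sep (t a) (P a)).
Proof.
move=> Ht HP; apply: (@DT_the (fun a B => forall x, x ∈ B <-> x ∈ t a /\ P a x)).
apply: (@D_all _ (fun a x => x ∈ a 0 <-> x ∈ t (fun i => a (S i)) /\ P (fun i => a (S i)) x)).
apply: D_iff; first by apply: D_mem; exact: DT_var.
apply: D_and; last exact: (D_ren (up S) HP).
apply: D_mem; first exact: DT_var.
exact: (DT_weaken (DT_weaken Ht)).
Qed.

(** Least with respect to membership. For [A = omega] this is the least number with the property,
    and it makes selections along an enumeration without any choice in the model. *)
Definition least (A : V) (P : V -> Prop) : V :=
  the (fun n => n ∈ sep A P /\ forall m, m ∈ n -> ~ m ∈ sep A P).

Lemma DT_least (t : (nat -> V) -> V) (P : (nat -> V) -> V -> Prop) :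
  DT t -> D (fun a => P (fun i => a (S i)) (a 0)) -> DT (fun a => least (t a) (P a)).
Proof.
move=> Ht HP; have Hs := DT_sep Ht HP.
apply: (@DT_the (fun a n => n ∈ sep (t a) (P a) /\ forall m, m ∈ n -> ~ m ∈ sep (t a) (P a))).
apply: D_and; first by apply: D_mem; [exact: DT_var|exact: (DT_weaken Hs)].
apply: (@D_all _ (fun a m => m ∈ a 0 ->
  ~ m ∈ sep (t (fun i => a (S i))) (P (fun i => a (S i))))).
apply: D_imp; first by apply: D_mem; exact: DT_var.
apply: D_not; apply: D_mem; first exact: DT_var.
exact: (DT_weaken (DT_weaken Hs)).
Qed.

End Description.

(** * Proof search for definability, following the shape of the expression *)

Ltac dfn_step :=
  cbv beta;
  lazymatch goal with
  | |- D (fun _ => ?P) => apply D_const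
  | |- D (fun a => @?P a /\ @?Q a) => apply (@D_and _ P Q)
  | |- D (fun a => @?P a \/ @?Q a) => apply (@D_or _ P Q)
  | |- D (fun a => @?P a <-> @?Q a) => apply (@D_iff _ P Q)
  | |- D (fun a => ~ @?P a) => apply (@D_not _ P)
  | |- D (fun a => exists x, @?P a x) => apply (@D_ex _ P)
  | |- D (fun a => exists! x, @?P a x) => apply (@D_exu _ P)
  | |- D (fun a => @?P a -> @?Q a) => apply (@D_imp _ P Q)
  | |- D (fun a => forall x, @?P a x) => apply (@D_all _ P)
  | |- D (fun a => elem (@?t a) (@?u a)) => apply (@D_mem _ t u)
  | |- D (fun a => @?t a = @?u a) => apply (@D_eq _ t u)
  | |- DT (fun a => a _) => apply DT_var
  | |- DT (fun _ => ?c) => apply DT_const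
  | |- DT (fun a => the (@?P a)) => apply (@DT_the _ _ P)
  | |- DT (fun a => sep (@?t a) (@?P a)) => apply (@DT_sep _ _ t P)
  | |- DT (fun a => least (@?t a) (@?P a)) => apply (@DT_least _ _ t P)
  | |- D _ =>
    match goal with
    | |- D (fun a => ?P (@?t a) (@?u a) (@?v a) (@?w a)) =>
      let H := constr:(_ : D4 P) in apply (@D_app4 _ P t u v w H)
    | |- D (fun a => ?P (@?t a) (@?u a) (@?v a)) =>
      let H := constr:(_ : D3 P) in apply (@D_app3 _ P t u v H)
    | |- D (fun a => ?P (@?t a) (@?u a)) =>
      let H := constr:(_ : D2 P) in apply (@D_app2 _ P t u H)
    | |- D (fun a => ?P (@?t a)) =>
      let H := constr:(_ : D1 P) in apply (@D_app1 _ P t H)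
    end
  | |- DT _ =>
    match goal with
    | |- DT (fun a => ?P (@?t a) (@?u a) (@?v a)) =>
      let H := constr:(_ : F3 P) in apply (@DT_app3 _ P t u v H)
    | |- DT (fun a => ?P (@?t a) (@?u a)) =>
      let H := constr:(_ : F2 P) in apply (@DT_app2 _ P t u H)
    | |- DT (fun a => ?P (@?t a)) =>
      let H := constr:(_ : F1 P) in apply (@DT_app1 _ P t H)
    end
  end.

Ltac dfn := repeat dfn_step.

Ltac dfn_class := unfold D1, D2, D3, D4, F1, F2, F3; solve [dfn].

Global Hint Extern 1 (D1 (fun _ => _)) => dfn_class : typeclass_instances.
Global Hint Extern 1 (D2 (fun _ => _)) => dfn_class : typeclass_instances.
Global Hint Extern 1 (D3 (fun _ => _)) => dfn_class : typeclass_instances.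
Global Hint Extern 1 (D4 (fun _ => _)) => dfn_class : typeclass_instances.
Global Hint Extern 1 (F1 (fun _ => _)) => dfn_class : typeclass_instances.
Global Hint Extern 1 (F2 (fun _ => _)) => dfn_class : typeclass_instances.
Global Hint Extern 1 (F3 (fun _ => _)) => dfn_class : typeclass_instances.

Global Instance F1_partial {V : membership_structure} (f : V -> V -> V) c : F2 f -> F1 (f c).
Proof. move=> H; dfn_class. Qed.
Global Instance D1_partial {V : membership_structure} (P : V -> V -> Prop) c : D2 P -> D1 (P c).
Proof. move=> H; dfn_class. Qed.
Global Instance D2_partial {V : membership_structure} (P : V -> V -> V -> Prop) c :
  D3 P -> D2 (P c).
Proof. move=> H; dfn_class. Qed.

(** * Elementary set theory *)

Section Sets.

Context {V : membership_structure} {HV : ZF V}.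

#[export] Instance D2_subset : D2 (@subset V).
Proof. unfold subset; dfn_class. Qed.
#[export] Instance D1_is_empty : D1 (@is_empty V).
Proof. unfold is_empty; dfn_class. Qed.
#[export] Instance D1_nonempty : D1 (@nonempty V).
Proof. unfold nonempty; dfn_class. Qed.
#[export] Instance D3_is_upair : D3 (@is_upair V).
Proof. unfold is_upair; dfn_class. Qed.
#[export] Instance D2_is_union : D2 (@is_union V).
Proof. unfold is_union; dfn_class. Qed.
#[export] Instance D2_is_succ : D2 (@is_succ V).
Proof. unfold is_succ; dfn_class. Qed.
#[export] Instance D1_inductive_set : D1 (@inductive_set V).
Proof. unfold inductive_set; dfn_class. Qed.
#[export] Instance D3_is_pair : D3 (@is_pair V).
Proof. unfold is_pair; dfn_class. Qed.
#[export] Instance D3_rel : D3 (@rel V).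
Proof. unfold rel; dfn_class. Qed.
#[export] Instance D4_rel2 : D4 (@rel2 V).
Proof. unfold rel2; dfn_class. Qed.
#[export] Instance D3_is_fun : D3 (@is_fun V).
Proof. unfold is_fun; dfn_class. Qed.
#[export] Instance D3_is_injection : D3 (@is_injection V).
Proof. unfold is_injection; dfn_class. Qed.
#[export] Instance D3_is_bijection : D3 (@is_bijection V).
Proof. unfold is_bijection; dfn_class. Qed.
#[export] Instance D1_is_nat : D1 (@is_nat V).
Proof. unfold is_nat; dfn_class. Qed.
#[export] Instance D1_finite : D1 (@finite V).
Proof. unfold finite; dfn_class. Qed.

Lemma subset_antisym (A B : V) : subset A B -> subset B A -> A = B.
Proof. by move=> H1 H2; apply: ext_eq => x; split; [apply: H1|apply: H2]. Qed.

Lemma ext_unique (Q : V -> Prop) (A B : V) :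
  (forall x, x ∈ A <-> Q x) -> (forall x, x ∈ B <-> Q x) -> A = B.
Proof. by move=> HA HB; apply: ext_eq => x; rewrite HA HB. Qed.

Definition emp : V := the (@is_empty V).

Lemma in_emp x : ~ x ∈ emp.
Proof.
move: x; apply: (the_sat (P := @is_empty V)); first exact: empty_exists.
by move=> y z Hy Hz; apply: (@ext_unique (fun _ => False)) => x; split=> // H;
  [case: (Hy x)|case: (Hz x)].
Qed.

Lemma is_empty_emp (A : V) : is_empty A <-> A = emp.
Proof.
split=> [H|->]; last exact: in_emp.
by apply: ext_eq => x; split=> Hx; [case: (H x)|case: (@in_emp x)].
Qed.

Definition upair (a b : V) : V := the (fun u => is_upair u a b).
#[export] Instance F2_upair : F2 upair.
Proof. unfold upair; dfn_class. Qed.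

Lemma is_upair_upair (a b u : V) : is_upair u a b <-> u = upair a b.
Proof.
have Hs : is_upair (upair a b) a b.
  apply: (the_sat (P := fun u => is_upair u a b)); first exact: (zf_pairing V HV).
  by move=> y z Hy Hz; apply: (ext_unique Hy Hz).
by split=> [Hu|->] //; apply: (ext_unique Hu Hs).
Qed.

Lemma in_upair x a b : x ∈ upair a b <-> x = a \/ x = b.
Proof. by move: x; apply/is_upair_upair. Qed.

Definition sing (a : V) : V := upair a a.
#[export] Instance F1_sing : F1 sing.
Proof. unfold sing; dfn_class. Qed.

Lemma in_sing x a : x ∈ sing a <-> x = a.
Proof. by rewrite in_upair; tauto. Qed.

Definition pr (a b : V) : V := upair (sing a) (upair a b).
#[export] Instance F2_pr : F2 pr.
Proof. unfold pr; dfn_class. Qed.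

Lemma is_pair_pr (p a b : V) : is_pair p a b <-> p = pr a b.
Proof.
split=> [[s [t [/is_upair_upair -> [/is_upair_upair -> /is_upair_upair ->]]]] //|->].
by exists (sing a), (upair a b); rewrite !is_upair_upair.
Qed.

Lemma sing_upair x a b : sing x = upair a b -> a = x /\ b = x.
Proof.
move=> H; split; apply/in_sing; rewrite H in_upair; auto.
Qed.

Lemma pr_inj a b c d : pr a b = pr c d -> a = c /\ b = d.
Proof.
move=> H.
have Hac : a = c.
  have: sing a ∈ pr c d by rewrite -H in_upair; left.
  by rewrite in_upair => -[/sing_upair [-> _]|/sing_upair [->]].
subst c; split=> //.
have half b' d' : pr a b' = pr a d' -> b' = a \/ b' = d'.
  move=> E; have: upair a b' ∈ pr a d' by rewrite -E in_upair; right.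
  have: b' ∈ upair a b' by rewrite in_upair; right.
  by rewrite (in_upair (upair a b')) => H1 [E'|E']; move: H1; rewrite E' !in_upair; tauto.
by case: (half _ _ H) => //; case: (half d b) => //; congruence.
Qed.

Lemma rel_pr (r a b : V) : rel r a b <-> pr a b ∈ r.
Proof.
split=> [[p [/is_pair_pr -> //]]|H]; by exists (pr a b); rewrite is_pair_pr.
Qed.

Lemma rel2_pr (f a b c : V) : rel2 f a b c <-> rel f (pr a b) c.
Proof.
split=> [[p [/is_pair_pr -> //]]|H]; by exists (pr a b); rewrite is_pair_pr.
Qed.

Definition union (A : V) : V := the (fun U => is_union U A).
#[export] Instance F1_union : F1 union.
Proof. unfold union; dfn_class. Qed.

Lemma is_union_union (A U : V) : is_union U A <-> U = union A.
Proof.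
have Hs : is_union (union A) A.
  apply: (the_sat (P := fun u => is_union u A)); first exact: (zf_union V HV).
  by move=> y z Hy Hz; apply: (ext_unique Hy Hz).
by split=> [Hu|->] //; apply: (ext_unique Hu Hs).
Qed.

Lemma in_union x A : x ∈ union A <-> exists y, y ∈ A /\ x ∈ y.
Proof. by move: x; apply/is_union_union. Qed.

Definition pow (A : V) : V := the (fun P => forall x, x ∈ P <-> subset x A).
#[export] Instance F1_pow : F1 pow.
Proof. unfold pow; dfn_class. Qed.

Lemma in_pow x A : x ∈ pow A <-> subset x A.
Proof.
move: x; apply: (the_sat (P := fun P => forall x, x ∈ P <-> subset x A)).
  exact: (zf_powerset V HV).
by move=> y z Hy Hz; apply: (ext_unique Hy Hz).
Qed.

Definition cup (A B : V) : V := union (upair A B).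
#[export] Instance F2_cup : F2 cup.
Proof. unfold cup; dfn_class. Qed.

Lemma in_cup x A B : x ∈ cup A B <-> x ∈ A \/ x ∈ B.
Proof.
rewrite in_union; split=> [[y [/in_upair [->|->]]]|[H|H]]; auto.
- by exists A; rewrite in_upair; auto.
- by exists B; rewrite in_upair; auto.
Qed.

Definition adj (A x : V) : V := cup A (sing x).
#[export] Instance F2_adj : F2 adj.
Proof. unfold adj; dfn_class. Qed.

Lemma in_adj y A x : y ∈ adj A x <-> y ∈ A \/ y = x.
Proof. by rewrite in_cup in_sing. Qed.

Definition cprod (A B : V) : V :=
  sep (pow (pow (cup A B))) (fun p => exists a b, a ∈ A /\ b ∈ B /\ p = pr a b).
#[export] Instance F2_cprod : F2 cprod.
Proof. unfold cprod; dfn_class. Qed.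

Lemma in_cprod p A B : p ∈ cprod A B <-> exists a b, a ∈ A /\ b ∈ B /\ p = pr a b.
Proof.
rewrite in_sep; split=> [[] //|[a [b [Ha [Hb ->]]]]]; split; last by exists a, b.
rewrite in_pow => s /in_upair Hs; rewrite in_pow => x Hx; rewrite in_cup.
by case: Hs Hx => -> /in_upair [->|->]; auto.
Qed.

Lemma pr_in_cprod a b A B : pr a b ∈ cprod A B <-> a ∈ A /\ b ∈ B.
Proof.
rewrite in_cprod; split=> [[c [d [Hc [Hd /pr_inj [-> ->]]]]] //|[Ha Hb]].
by exists a, b.
Qed.

Lemma is_prod_cprod (P A B : V) : is_prod P A B <-> P = cprod A B.
Proof.
have H p : (exists a b, a ∈ A /\ b ∈ B /\ is_pair p a b) <-> p ∈ cprod A B.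
  rewrite in_cprod; split=> -[a [b [Ha [Hb Hp]]]]; exists a, b; split=> //; split=> //;
  by apply/is_pair_pr.
split=> [HP|-> p]; last by rewrite -H.
by apply: ext_eq => q; rewrite HP H.
Qed.

Definition pfst (p : V) : V := the (fun a => exists b, p = pr a b).
Definition psnd (p : V) : V := the (fun b => exists a, p = pr a b).
#[export] Instance F1_pfst : F1 pfst.
Proof. unfold pfst; dfn_class. Qed.
#[export] Instance F1_psnd : F1 psnd.
Proof. unfold psnd; dfn_class. Qed.

Lemma pfst_pr a b : pfst (pr a b) = a.
Proof. by apply: the_eq => [|z [c /pr_inj [-> _]]] //; exists b. Qed.

Lemma psnd_pr a b : psnd (pr a b) = b.
Proof. by apply: the_eq => [|z [c /pr_inj [_ ->]]] //; exists a. Qed.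

(** * Functions *)

Definition app (f a : V) : V := the (fun b => rel f a b).
#[export] Instance F2_app : F2 app.
Proof. unfold app; dfn_class. Qed.

Lemma rel_in (f A B a b : V) : is_fun f A B -> rel f a b -> a ∈ A /\ b ∈ B.
Proof.
move=> [H _] /rel_pr /H [c [d [Hc [Hd /is_pair_pr /pr_inj [-> ->]]]]] //.
Qed.

Lemma rel_fun (f A B a b : V) : is_fun f A B -> rel f a b <-> a ∈ A /\ b = app f a.
Proof.
move=> Hf; split.
  move=> Hab; have [Ha Hb] := rel_in Hf Hab; split=> //; symmetry; apply: the_eq => // z Hz.
  by have [c [_ Hc]] := proj2 Hf a Ha; rewrite -(Hc b Hab) -(Hc z Hz).
move=> [Ha ->]; have [c [Hc Hu]] := proj2 Hf a Ha.
by apply: the_sat; [exists c|move=> y z /Hu <- /Hu <-].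
Qed.

Lemma rel_app (f A B a : V) : is_fun f A B -> a ∈ A -> rel f a (app f a).
Proof. by move=> Hf Ha; apply/(rel_fun _ _ Hf). Qed.

Lemma app_in (f A B a : V) : is_fun f A B -> a ∈ A -> app f a ∈ B.
Proof. by move=> Hf Ha; case: (rel_in Hf (rel_app Hf Ha)). Qed.

Lemma app_eq (f A B a b : V) : is_fun f A B -> rel f a b -> app f a = b.
Proof. by move=> Hf /(rel_fun _ _ Hf) [_ ->]. Qed.

Lemma in_fun (f A B p : V) : is_fun f A B -> p ∈ f -> exists a, a ∈ A /\ p = pr a (app f a).
Proof.
move=> Hf Hp; have [a [b [Ha [Hb /is_pair_pr E]]]] := proj1 Hf p Hp.
exists a; split=> //; rewrite E; congr pr; symmetry; apply: (app_eq Hf).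
by rewrite rel_pr -E.
Qed.

Lemma fun_intro (f A B : V) : subset f (cprod A B) ->
  (forall a, a ∈ A -> exists b, rel f a b) ->
  (forall a b c, rel f a b -> rel f a c -> b = c) -> is_fun f A B.
Proof.
move=> Hs He Hu; split.
  move=> p /Hs /in_cprod [a [b [Ha [Hb ->]]]]; exists a, b; by rewrite is_pair_pr.
by move=> a /He [b Hb]; exists b; split=> // c; apply: Hu.
Qed.

(** A function determines its domain; hence the length of a partial choice function is well
    defined. *)
Lemma fun_dom (f A B A' B' : V) : is_fun f A B -> is_fun f A' B' -> A = A'.
Proof.
move=> H H'; apply: ext_eq => x; split=> Hx.
  by case: (rel_in H' (rel_app H Hx)).
by case: (rel_in H (rel_app H' Hx)).
Qed.

Definition lam (A B : V) (F : V -> V) : V :=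
  sep (cprod A B) (fun p => exists a, p = pr a (F a)).

Lemma rel_lam (A B : V) F {HF : F1 F} a b :
  rel (lam A B F) a b <-> a ∈ A /\ b ∈ B /\ b = F a.
Proof.
rewrite rel_pr in_sep pr_in_cprod.
split=> [[[Ha Hb] [c /pr_inj [Ec Eb]]]|[Ha [Hb E]]]; first by subst c.
by subst b; split=> //; exists a.
Qed.

Lemma lam_fun (A B : V) F {HF : F1 F} :
  (forall a, a ∈ A -> F a ∈ B) -> is_fun (lam A B F) A B.
Proof.
move=> H; apply: fun_intro.
- by move=> p; rewrite in_sep => -[].
- by move=> a Ha; exists (F a); rewrite rel_lam; auto.
- by by move=> a b c; rewrite !rel_lam => -[_ [_ ->]] [_ [_ ->]].
Qed.

Lemma app_lam (A B : V) F {HF : F1 F} a :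
  (forall a, a ∈ A -> F a ∈ B) -> a ∈ A -> app (lam A B F) a = F a.
Proof.
by move=> H Ha; apply: (app_eq (lam_fun H)); rewrite rel_lam; auto.
Qed.

Definition app2 (f a b : V) : V := app f (pr a b).
#[export] Instance F3_app2 : F3 app2.
Proof. unfold app2; dfn_class. Qed.

Lemma is_fun2_cprod (f A B C : V) : is_fun2 f A B C <-> is_fun f (cprod A B) C.
Proof.
split=> [[P [/is_prod_cprod -> //]]|H]; by exists (cprod A B); rewrite is_prod_cprod.
Qed.

Lemma rel2_fun (f A B C a b c : V) : is_fun2 f A B C ->
  rel2 f a b c <-> a ∈ A /\ b ∈ B /\ c = app2 f a b.
Proof.
by move=> /is_fun2_cprod Hf; rewrite rel2_pr (rel_fun _ _ Hf) pr_in_cprod; tauto.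
Qed.

Lemma app2_in (f A B C a b : V) : is_fun2 f A B C -> a ∈ A -> b ∈ B -> app2 f a b ∈ C.
Proof.
by move=> /is_fun2_cprod Hf Ha Hb; apply: (app_in Hf); rewrite pr_in_cprod.
Qed.

Lemma fun2_exists (A B C : V) F {HF : F2 F} :
  (forall a b, a ∈ A -> b ∈ B -> F a b ∈ C) ->
  exists f, is_fun2 f A B C /\ forall a b, a ∈ A -> b ∈ B -> app2 f a b = F a b.
Proof.
move=> H; pose (G := fun p => F (pfst p) (psnd p)).
have HG : F1 G by rewrite /G; exact _.
have HGC p : p ∈ cprod A B -> G p ∈ C.
  by move=> /in_cprod [a [b [Ha [Hb ->]]]]; rewrite /G pfst_pr psnd_pr; apply: H.
exists (lam (cprod A B) C G); split; first by apply/is_fun2_cprod; apply: lam_fun.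
by move=> a b Ha Hb; rewrite /app2 app_lam ?pr_in_cprod // /G pfst_pr psnd_pr.
Qed.

End Sets.

(** * Natural numbers *)

Section Naturals.

Context {V : membership_structure} {HV : ZF V}.

Definition suc (n : V) : V := adj n n.
#[export] Instance F1_suc : F1 suc.
Proof. unfold suc; dfn_class. Qed.

Lemma in_suc x n : x ∈ suc n <-> x ∈ n \/ x = n.
Proof. exact: in_adj. Qed.

Lemma suc_neq_emp n : suc n <> emp.
Proof. by move=> E; apply: (@in_emp _ _ n); rewrite -E in_suc; right. Qed.

Lemma inductive_setE (I : V) :
  inductive_set I <-> emp ∈ I /\ forall n, n ∈ I -> suc n ∈ I.
Proof.
have Hsuc n s : is_succ s n <-> s = suc n.
  split=> [H|-> x]; last by rewrite in_suc.
  by apply: ext_eq => x; rewrite in_suc (H x).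
split=> [[[z [/is_empty_emp -> Hz]] HI]|[H0 HI]]; split=> //.
- by move=> n /HI [s [/Hsuc ->]].
- by exists emp; rewrite is_empty_emp.
- by move=> n Hn; exists (suc n); rewrite Hsuc; auto.
Qed.

Definition omega : V := the (@is_omega V).

Lemma in_omega n : n ∈ omega <-> is_nat n.
Proof.
move: n; apply: (the_sat (P := @is_omega V)); last by move=> y z Hy Hz; apply: (ext_unique Hy Hz).
have [I HI] := zf_infinity V HV; exists (sep I (@is_nat V)) => n.
by rewrite in_sep; split=> [[]|Hn] //; split=> //; apply: Hn.
Qed.

Lemma is_omega_omega (w : V) : is_omega w <-> w = omega.
Proof. by split=> [Hw|->]; [apply: (ext_unique Hw); exact: in_omega|exact: in_omega]. Qed.

Lemma emp_omega : emp ∈ omega.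
Proof. by apply/in_omega => I /inductive_setE []. Qed.

Lemma suc_omega n : n ∈ omega -> suc n ∈ omega.
Proof.
by rewrite !in_omega => Hn I HI; case/inductive_setE: (HI) => _; apply; apply: Hn.
Qed.

(** Induction takes place inside the model, whose [omega] may contain non-standard numbers. The
    predicate must therefore cut out a set, [sep omega Q], which is then inductive. *)
Lemma omega_ind (Q : V -> Prop) {HQ : D1 Q} : Q emp ->
  (forall n, n ∈ omega -> Q n -> Q (suc n)) -> forall n, n ∈ omega -> Q n.
Proof.
move=> H0 HS n /in_omega Hn.
have: n ∈ sep omega Q.
  apply: Hn; rewrite inductive_setE in_sep; split; first by split=> //; exact: emp_omega.
  by move=> m; rewrite !in_sep => -[Hm Qm]; split; [apply: suc_omega|apply: HS].
by rewrite in_sep => -[].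
Qed.

Lemma omega_case n : n ∈ omega -> n = emp \/ exists m, m ∈ omega /\ n = suc m.
Proof.
move: n; apply: omega_ind; first by left.
by move=> n Hn _; right; exists n.
Qed.

Lemma mem_irrefl (x : V) : ~ x ∈ x.
Proof.
move=> H; have [|y [/in_sing -> Hy]] := zf_foundation V HV (sing x).
  by exists x; rewrite in_sing.
by apply: (Hy x H); rewrite in_sing.
Qed.

Lemma nat_transitive n : n ∈ omega -> forall m, m ∈ n -> subset m n.
Proof.
move: n; apply: omega_ind => [m /in_emp //|n Hn IH m].
rewrite in_suc => -[/IH H|->] x Hx; rewrite in_suc; auto.
Qed.

Lemma nat_in_omega n m : n ∈ omega -> m ∈ n -> m ∈ omega.
Proof.
move=> Hn; move: n Hn m; apply: omega_ind => [m /in_emp //|n Hn IH m].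
by rewrite in_suc => -[/IH|->].
Qed.

Lemma nat_lt_trans a b c : c ∈ omega -> a ∈ b -> b ∈ c -> a ∈ c.
Proof. by move=> Hc Ha Hb; apply: (nat_transitive Hc Hb). Qed.

Lemma nat_lt_asym a b : a ∈ omega -> a ∈ b -> ~ b ∈ a.
Proof. by move=> Ha H1 H2; apply: (mem_irrefl (nat_lt_trans Ha H1 H2)). Qed.

Lemma emp_in_suc n : n ∈ omega -> emp ∈ suc n.
Proof.
move: n; apply: omega_ind => [|n Hn IH]; first by rewrite in_suc; right.
by rewrite in_suc; left.
Qed.

Lemma suc_in_suc n : n ∈ omega -> forall m, m ∈ n -> suc m ∈ suc n.
Proof.
move: n; apply: omega_ind => [m /in_emp //|n Hn IH m].
by rewrite in_suc (in_suc _ (suc n)) => -[/IH|->]; auto.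
Qed.

Lemma nat_trichotomy n : n ∈ omega -> forall m, m ∈ omega -> m ∈ n \/ m = n \/ n ∈ m.
Proof.
move: n; apply: omega_ind => [m /omega_case [->|[k [Hk ->]]]|n Hn IH m Hm]; auto.
  by right; right; apply: emp_in_suc.
case: (IH m Hm) => [H|[->|H]].
- by left; rewrite in_suc; left.
- by left; rewrite in_suc; right.
- by move/(suc_in_suc Hm): H; rewrite in_suc => -[H|->]; auto.
Qed.

Lemma nat_not_lt n m : n ∈ omega -> m ∈ omega -> ~ m ∈ n -> n ∈ suc m.
Proof.
move=> Hn Hm H; rewrite in_suc; case: (nat_trichotomy Hn Hm) => [//|[->|]]; auto.
Qed.

Lemma suc_inj n m : n ∈ omega -> m ∈ omega -> suc n = suc m -> n = m.
Proof.
move=> Hn Hm E; case: (nat_trichotomy Hm Hn) => [H|[//|H]].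
  by have := suc_in_suc Hm H; rewrite E => /mem_irrefl.
by have := suc_in_suc Hn H; rewrite E => /mem_irrefl.
Qed.

(** Existence comes from foundation applied to [sep omega P], uniqueness from trichotomy. *)
Lemma least_spec (P : V -> Prop) {HP : D1 P} : (exists n, n ∈ omega /\ P n) ->
  least omega P ∈ omega /\ P (least omega P) /\
  forall m, m ∈ omega -> P m -> ~ m ∈ least omega P.
Proof.
move=> [n Hn].
have [||Hin Hmin] := @the_sat _ _
    (fun n => n ∈ sep omega P /\ forall m, m ∈ n -> ~ m ∈ sep omega P).
- have [|m [Hm Hmin]] := zf_foundation V HV (sep omega P).
    by exists n; rewrite in_sep.
  by exists m.
- move=> y z [Hy Hy'] [Hz Hz']; move: (Hy) (Hz); rewrite !in_sep => -[Hy1 _] [Hz1 _].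
  by case: (nat_trichotomy Hz1 Hy1) => [/Hz'|[//|/Hy']].
- move: Hin; rewrite in_sep => -[H1 H2]; split=> //; split=> // m Hm Pm H.
  by apply: (Hmin m H); rewrite in_sep.
Qed.

(** The function is the least set of pairs that contains [pr emp a] and is closed under passing from
    [pr n x] to [pr (suc n) (F x)]. By minimality no pair can be deleted without destroying closure
    ([del]), so every pair arises by one of these two rules; single-valuedness follows by
    induction. *)
Lemma recursion (A a : V) (F : V -> V) {HF : F1 F} :
  a ∈ A -> (forall x, x ∈ A -> F x ∈ A) ->
  exists f, is_fun f omega A /\ app f emp = a /\
    forall n, n ∈ omega -> app f (suc n) = F (app f n).
Proof.
move=> Ha HA.
pose (closed := fun (K : V) => pr emp a ∈ K /\ forall n x, n ∈ omega -> x ∈ A ->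
  pr n x ∈ K -> pr (suc n) (F x) ∈ K).
have Dc : D1 closed by rewrite /closed; exact _.
pose (f := sep (cprod omega A) (fun p => forall K, closed K -> p ∈ K)).
have in_f p : p ∈ f <-> p ∈ cprod omega A /\ forall K, closed K -> p ∈ K by rewrite in_sep.
clearbody f.
have f0 : pr emp a ∈ f.
  by rewrite in_f pr_in_cprod; split; [split=> //; exact: emp_omega|move=> K []].
have fS n x : pr n x ∈ f -> pr (suc n) (F x) ∈ f.
  rewrite !in_f !pr_in_cprod => -[[Hn Hx] H]; split.
    by split; [apply: suc_omega|apply: HA].
  by move=> K HK; apply: (proj2 HK) => //; apply: H.
have del p : p ∈ f -> closed (sep f (fun q => q <> p)) -> False.
  by rewrite in_f => -[_ Hp] /Hp; rewrite in_sep => -[].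
have f0' x : pr emp x ∈ f -> x = a.
  move=> Hx; apply: NNPP => Hxa; apply: (del _ Hx); split.
    by rewrite in_sep; split=> // /pr_inj [_ E]; apply: Hxa.
  move=> n z Hn Hz; rewrite !in_sep => -[H _]; split; first exact: fS.
  by move/pr_inj => [/suc_neq_emp].
have funct : forall n, n ∈ omega -> forall x y, pr n x ∈ f -> pr n y ∈ f -> x = y.
  apply: omega_ind => [x y /f0' -> /f0' -> //|n Hn IH].
  (* A pair over [suc n] that is not produced from a pair over [n] could be deleted. *)
  have step z : (exists x, pr n x ∈ f /\ z = F x) \/ ~ pr (suc n) z ∈ f.
    case: (classic (pr (suc n) z ∈ f)) => Hz; auto; left.
    apply: NNPP => Hno; apply: (del _ Hz); split.
      by rewrite in_sep; split=> // /pr_inj [E _]; apply: (@suc_neq_emp n).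
    move=> m x Hm Hx; rewrite !in_sep => -[H _]; split; first exact: fS.
    move/pr_inj => [/suc_inj E1 E2]; apply: Hno; exists x; split=> //.
    by rewrite -E1.
  move=> x y; case: (step x) => [[x' [Hx' ->]]|//] _.
  by case: (step y) => [[y' [Hy' ->]]|//] _; rewrite (IH x' y').
have total : forall n, n ∈ omega -> exists x, x ∈ A /\ pr n x ∈ f.
  apply: omega_ind; first by exists a.
  by move=> n Hn [x [Hx Hnx]]; exists (F x); split; [apply: HA|apply: fS].
have Hf : is_fun f omega A.
{ apply: fun_intro.
  - by move=> p; rewrite in_f => -[].
  - by move=> n /total [x [_ Hx]]; exists x; rewrite rel_pr.
  - move=> n x y; rewrite !rel_pr => Hx; apply: (funct n _ x y) => //.
    by move: Hx; rewrite in_f pr_in_cprod => -[[]]. }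
exists f; split; first by [].
split; first by apply: (app_eq Hf); rewrite rel_pr.
move=> n Hn; apply: (app_eq Hf); rewrite rel_pr; apply: fS.
by rewrite -rel_pr; apply: (rel_app Hf).
Qed.

End Naturals.

(** * Finite sets *)

Section FiniteSets.

Context {V : membership_structure} {HV : ZF V}.
Implicit Types A B F L : V.

Lemma bijection_intro A B G {HG : F1 G} :
  (forall a, a ∈ A -> G a ∈ B) ->
  (forall a a', a ∈ A -> a' ∈ A -> G a = G a' -> a = a') ->
  (forall b, b ∈ B -> exists a, a ∈ A /\ G a = b) ->
  is_bijection (lam A B G) A B.
Proof.
move=> HB Hinj Hsur; split; first split; first exact: lam_fun.
  by move=> a a' b; rewrite !rel_lam => -[Ha [_ ->]] [Ha' [_ /Hinj]]; auto.
by move=> b Hb; have [a [Ha E]] := Hsur b Hb; exists a; rewrite rel_lam.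
Qed.

Lemma bijection_app A B f : is_bijection f A B ->
  is_fun f A B /\
  (forall a a', a ∈ A -> a' ∈ A -> app f a = app f a' -> a = a') /\
  (forall b, b ∈ B -> exists a, a ∈ A /\ app f a = b).
Proof.
move=> [[Hf Hi] Hs]; split; first by [].
split.
  move=> a a' Ha Ha' E; apply: (Hi _ _ (app f a)); first exact: (rel_app Hf).
  by rewrite E; apply: (rel_app Hf).
by move=> b /Hs [a Hab]; exists a; have [Ha ->] := proj1 (rel_fun _ _ Hf) Hab.
Qed.

Lemma finite_ext A B : finite A -> (forall x, x ∈ A <-> x ∈ B) -> finite B.
Proof. by move=> HA /ext_eq <-. Qed.

Lemma finite_emp : finite (emp : V).
Proof.
exists emp, (lam emp emp (fun x => x)); split; first by apply/in_omega; exact: emp_omega.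
by apply: bijection_intro => [x /in_emp|x y /in_emp|x /in_emp].
Qed.

Lemma adj_id A x : x ∈ A -> adj A x = A.
Proof. by move=> Hx; apply: ext_eq => y; rewrite in_adj; split=> [[//|->]|]; auto. Qed.

Lemma finite_adj A x : finite A -> finite (adj A x).
Proof.
case: (classic (x ∈ A)) => [/adj_id -> //|Hx [n [f [Hn /bijection_app [Hf [Hi Hs]]]]]].
move/in_omega: Hn => Hn.
(* Definitions by cases are written with [the], so that they remain definable. The second case
   serves for [k = n], the new last number, which is not a member of itself. *)
pose (G := fun k => the (fun b => k ∈ n /\ b = app f k \/ ~ k ∈ n /\ b = x)).
have HG : F1 G by rewrite /G; exact _.
have G1 k : k ∈ n -> G k = app f k.
  by move=> Hk; apply: the_eq => [|z [[]|[]]] //; left.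
have G2 : G n = x.
  apply: the_eq => [|z [[/mem_irrefl]|[]]] //; right; split=> //; exact: mem_irrefl.
exists (suc n), (lam (suc n) (adj A x) G); split.
  by apply/in_omega; exact: suc_omega.
apply: bijection_intro.
- move=> k; rewrite in_suc in_adj => -[Hk|->]; last by right.
  by left; rewrite G1 //; exact: (app_in Hf).
- move=> k k'; rewrite !in_suc => -[Hk|->] [Hk'|->] //.
  + by rewrite !G1 //; exact: Hi.
  + by rewrite G2 G1 // => E; case: Hx; rewrite -E; exact: (app_in Hf).
  + by rewrite G2 G1 // => E; case: Hx; rewrite E; exact: (app_in Hf).
- move=> b; rewrite in_adj => -[/Hs [k [Hk <-]]|->].
    by exists k; rewrite in_suc G1; auto.
  by exists n; rewrite in_suc; auto.
Qed.

(** Induction on the number of elements: from a bijection of [suc n] with [A], deleting the value at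
    [n] leaves a set with [n] elements. *)
Lemma finite_ind (Q : V -> Prop) {HQ : D1 Q} : Q emp ->
  (forall A x, finite A -> ~ x ∈ A -> Q A -> Q (adj A x)) ->
  forall A, finite A -> Q A.
Proof.
move=> Q0 QS A [n [f [/in_omega Hn Hf]]].
(* Finiteness is proved along with [Q], because [QS] asks for it at the smaller set. *)
have H : forall n, n ∈ omega -> forall A f, is_bijection f n A -> finite A /\ Q A;
  last by case: (H n Hn A f Hf).
move=> {A n f Hn Hf}; apply: omega_ind.
  move=> A f /bijection_app [_ [_ Hs]].
  have -> : A = emp by apply/is_empty_emp => b /Hs [a [/in_emp]].
  by split=> //; exact: finite_emp.
move=> n Hn IH A f /bijection_app [Hf [Hi Hs]].
have nS : n ∈ suc n by rewrite in_suc; right.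
have kS k : k ∈ n -> k ∈ suc n by rewrite in_suc; left.
pose (A' := sep A (fun b => b <> app f n)).
have in_A' b : b ∈ A' <-> b ∈ A /\ b <> app f n by rewrite in_sep.
have EA : A = adj A' (app f n).
  apply: ext_eq => b; rewrite in_adj in_A'; split=> [Hb|[[]|->]] //.
    by case: (classic (b = app f n)); auto.
  exact: (app_in Hf).
have [|FA' QA'] := IH A' (lam n A' (app f)).
{ apply: bijection_intro.
  - move=> k Hk; rewrite in_A'; split; first by apply: (app_in Hf); auto.
    by move/Hi => E; apply: (@mem_irrefl _ _ n); rewrite -{1}E; auto.
  - by move=> k k' Hk Hk'; apply: Hi; auto.
  - move=> b; rewrite in_A' => -[/Hs [k [/in_suc [Hk|->] <-]] //].
    by exists k. }
rewrite EA; split; first exact: finite_adj.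
by apply: QS => //; rewrite in_A' => -[].
Qed.

Lemma finite_subset A : finite A -> forall B, subset B A -> finite B.
Proof.
move: A; apply: finite_ind => [B H|A x HA Hx IH B HB].
  have -> : B = emp by apply/is_empty_emp => b /H /in_emp.
  exact: finite_emp.
pose (B' := sep B (fun y => y <> x)).
have FB' : finite B'.
  apply: IH => y; rewrite in_sep => -[/HB].
  by rewrite in_adj; tauto.
case: (classic (x ∈ B)) => HxB.
  apply: (finite_ext (finite_adj x FB')) => y; rewrite in_adj in_sep.
  split=> [[[]|->] //|Hy].
  by case: (classic (y = x)); auto.
apply: (finite_ext FB') => y; rewrite in_sep; split=> [[]//|Hy]; split=> // E.
by apply: HxB; rewrite -E.
Qed.

Lemma finite_cup A B : finite A -> finite B -> finite (cup A B).
Proof.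
move=> HA; move: B; apply: finite_ind.
  by apply: (finite_ext HA) => x; rewrite in_cup; split=> [|[//|/in_emp]]; auto.
move=> B x _ _ /(finite_adj x) H.
by apply: (finite_ext H) => y; rewrite in_cup !in_adj in_cup; tauto.
Qed.

Lemma finite_sing x : finite (sing x : V).
Proof.
apply: (finite_ext (finite_adj x finite_emp)) => y; rewrite in_adj in_sing.
by split=> [[/in_emp|]|]; auto.
Qed.

(** No choice is involved: the induction on [F] uses one finite bound at a time, and only the
    existence of a bound for the union is kept. *)
Lemma finite_bigcup (P : V -> V -> Prop) {HP : D2 P} F : finite F ->
  (forall c, c ∈ F -> exists B, finite B /\ forall x, P c x -> x ∈ B) ->
  exists B, finite B /\ forall c x, c ∈ F -> P c x -> x ∈ B.
Proof.
move: F; apply: finite_ind.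
  by move=> _; exists emp; split; [exact: finite_emp|move=> c x /in_emp].
move=> F c HF _ IH H.
have [|B [HB HBF]] := IH; first by move=> c' Hc'; apply: H; rewrite in_adj; left.
have [|C [HC HCF]] := H c; first by rewrite in_adj; right.
exists (cup B C); split; first exact: finite_cup.
move=> c' x; rewrite in_adj in_cup => -[Hc' /HBF|-> /HCF]; auto.
Qed.

Lemma finite_image G {HG : F1 G} F : finite F ->
  exists B, finite B /\ forall c, c ∈ F -> G c ∈ B.
Proof.
move=> HF; have [c Hc|B [HB H]] := @finite_bigcup (fun c x => x = G c) _ F HF.
  by exists (sing (G c)); split=> [|x ->]; [exact: finite_sing|rewrite in_sing].
by exists B; split=> // c Hc; apply: H Hc _.
Qed.

Lemma finite_cprod A B : finite A -> finite B -> finite (cprod A B).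
Proof.
move=> HA HB.
have [a Ha|C [HC H]] := @finite_bigcup (fun a p => exists b, b ∈ B /\ p = pr a b) _ A HA.
  have [C [HC H]] := @finite_image (fun b => pr a b) _ B HB.
  by exists C; split=> // p [b [Hb ->]]; apply: H.
apply: (finite_subset HC) => p /in_cprod [a [b [Ha [Hb ->]]]].
by apply: (H a) => //; exists b.
Qed.

Lemma finite_pow A : finite A -> finite (pow A).
Proof.
move: A; apply: finite_ind.
  apply: (finite_subset (finite_sing emp)) => B; rewrite in_pow in_sing => HB.
  by apply/is_empty_emp => x /HB /in_emp.
move=> A x HA Hx HP.
have [C [HC H]] := @finite_image (fun S => adj S x) _ _ HP.
apply: (finite_subset (finite_cup HP HC)) => B; rewrite in_pow in_cup => HB.
have Hsub : sep B (fun y => y <> x) ∈ pow A.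
  by rewrite in_pow => y; rewrite in_sep => -[/HB]; rewrite in_adj; tauto.
case: (classic (x ∈ B)) => HxB; [right|left].
  have -> : B = adj (sep B (fun y => y <> x)) x; last exact: H.
  apply: ext_eq => y; rewrite in_adj in_sep; split=> [Hy|[[]|->]] //.
  by case: (classic (y = x)); auto.
rewrite in_pow => y Hy; case/in_adj: (HB y Hy) => // E.
by case: HxB; rewrite -E.
Qed.

(** An [x] may be related to several [c], but each [c] belongs to at most one [x]. So [A] lies in
    the image of [F] under the map taking [c] to its [x], and no [c] has to be selected. *)
Lemma finite_of_injective_relation (P : V -> V -> Prop) {HP : D2 P} A F : finite F ->
  (forall x, x ∈ A -> exists c, c ∈ F /\ P x c) ->
  (forall x y c, x ∈ A -> y ∈ A -> P x c -> P y c -> x = y) -> finite A.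
Proof.
move=> HF Hex Hinj.
have [B [HB H]] := @finite_image (fun c => the (fun x => x ∈ A /\ P x c)) _ F HF.
apply: (finite_subset HB) => x Hx; have [c [Hc Hxc]] := Hex x Hx.
have -> : x = the (fun x => x ∈ A /\ P x c); last exact: H.
by symmetry; apply: the_eq => // z [Hz Hzc]; apply: Hinj Hzc Hxc.
Qed.

(** Finite choice by induction. The witnesses are gathered in a finite set instead of a function,
    which is the form needed for extracting subcovers and centres of balls. *)
Lemma finite_selection (P : V -> V -> Prop) {HP : D2 P} B F : finite F ->
  (forall a, a ∈ F -> exists b, b ∈ B /\ P a b) ->
  exists C, finite C /\ subset C B /\ forall a, a ∈ F -> exists b, b ∈ C /\ P a b.
Proof.
move: F; apply: finite_ind.
  by move=> _; exists emp; split; [exact: finite_emp|split=> [x|x] /in_emp].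
move=> F a HF _ IH H.
have [|C [HC [HCB HCF]]] := IH; first by move=> c' Hc'; apply: H; rewrite in_adj; left.
have [|b [Hb Hab]] := H a; first by rewrite in_adj; right.
exists (adj C b); split; first exact: finite_adj.
split; first by move=> x; rewrite in_adj => -[/HCB|->].
move=> a'; rewrite in_adj => -[/HCF [c [Hc Hac]]|->]; last by exists b; rewrite in_adj; auto.
by exists c; rewrite in_adj; auto.
Qed.

Lemma finite_max (lt : V -> V -> Prop) {Hlt : D2 lt} A : finite A -> nonempty A ->
  (forall x y z, x ∈ A -> y ∈ A -> z ∈ A -> lt x y -> lt y z -> lt x z) ->
  (forall x y, x ∈ A -> y ∈ A -> lt x y \/ x = y \/ lt y x) ->
  exists m, m ∈ A /\ forall x, x ∈ A -> x = m \/ lt x m.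
Proof.
move: A; apply: finite_ind => [[x /in_emp] //|A a HA Ha IH _ Htr Htot].
have sub x : x ∈ A -> x ∈ adj A a by rewrite in_adj; left.
have aA : a ∈ adj A a by rewrite in_adj; right.
case: (classic (nonempty A)) => [Hne|He]; last first.
  exists a; split=> // x; rewrite in_adj => -[Hx|->]; last by left.
  by case: He; exists x.
have [||m [Hm Hmax]] := IH Hne.
{ by move=> x y z Hx Hy Hz; apply: Htr; auto. }
{ by move=> x y Hx Hy; apply: Htot; auto. }
case: (Htot a m aA (sub m Hm)) => [H|[H|H]].
- by exists m; split; auto; move=> x; rewrite in_adj => -[/Hmax|->]; auto.
- by subst a; case: Ha.
- exists a; split=> // x; rewrite in_adj => -[Hx|->]; last by left.
  right; case: (Hmax x Hx) => [-> //|H'].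
  by apply: Htr H; auto.
Qed.

Lemma nat_finite n : n ∈ omega -> finite (n : V).
Proof.
by move: n; apply: omega_ind => [|n _ /finite_adj]; [exact: finite_emp|exact].
Qed.

Definition linear_order (L A : V) : Prop :=
  subset L (cprod A A) /\
  (forall x, ~ pr x x ∈ L) /\
  (forall x y z, pr x y ∈ L -> pr y z ∈ L -> pr x z ∈ L) /\
  (forall x y, x ∈ A -> y ∈ A -> pr x y ∈ L \/ x = y \/ pr y x ∈ L).
#[export] Instance D2_linear_order : D2 linear_order.
Proof. unfold linear_order; dfn_class. Qed.

Lemma finite_linear_order A : finite A -> exists L, linear_order L A.
Proof.
move=> [n [f [/in_omega Hn /bijection_app [Hf [Hi Hs]]]]].
pose (L := sep (cprod A A) (fun p => exists i j, i ∈ j /\ j ∈ n /\ p = pr (app f i) (app f j))).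
have jn i j : i ∈ j -> j ∈ n -> i ∈ n by move=> Hij Hj; apply: (nat_lt_trans Hn Hij Hj).
have in_L x y : pr x y ∈ L <-> exists i j, i ∈ j /\ j ∈ n /\ x = app f i /\ y = app f j.
  rewrite in_sep pr_in_cprod; split.
    by move=> [_ [i [j [Hij [Hj /pr_inj [-> ->]]]]]]; exists i, j.
  move=> [i [j [Hij [Hj [-> ->]]]]]; split; last by exists i, j.
  by split; apply: (app_in Hf) => //; apply: jn Hij Hj.
exists L; split; first by move=> p; rewrite in_sep => -[].
split; first by move=> x /in_L [i [j [Hij [Hj [-> /Hi E]]]]];
  apply: (@mem_irrefl _ _ i); rewrite {2}E //; apply: jn Hij Hj.
split.
  move=> x y z /in_L [i [j [Hij [Hj [-> ->]]]]] /in_L [k [l [Hkl [Hl [/Hi E ->]]]]].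
  apply/in_L; exists i, l; split=> //.
  rewrite (E Hj (jn _ _ Hkl Hl)) in Hij.
  by apply: (nat_lt_trans (nat_in_omega Hn Hl) Hij Hkl).
move=> x y /Hs [i [Hi' <-]] /Hs [j [Hj <-]]; rewrite !in_L.
case: (nat_trichotomy (nat_in_omega Hn Hi') (nat_in_omega Hn Hj)) => [H|[->|H]]; auto.
- by right; right; exists j, i.
- by left; exists i, j.
Qed.

End FiniteSets.

(** * Countable sets *)

Section Countable.

Context {V : membership_structure} {HV : ZF V}.

Lemma app_bijection (A B f : V) : is_fun f A B ->
  (forall a a', a ∈ A -> a' ∈ A -> app f a = app f a' -> a = a') ->
  (forall b, b ∈ B -> exists a, a ∈ A /\ app f a = b) -> is_bijection f A B.
Proof.
move=> Hf Hi Hs; split; first split=> //.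
  by move=> a a' b /(rel_fun _ _ Hf) [Ha ->] /(rel_fun _ _ Hf) [Ha' /Hi]; auto.
by move=> b /Hs [a [Ha <-]]; exists a; apply: (rel_app Hf).
Qed.

(** Finite and denumerable sets are treated alike: past the domain of a finite enumeration [app]
    takes a default value, possibly outside [X]. *)
Lemma countable_enumeration (X : V) : countable X ->
  exists f, forall x, x ∈ X -> exists m, m ∈ omega /\ app f m = x.
Proof.
case=> [[n [f [/in_omega Hn /bijection_app [_ [_ Hs]]]]]|
        [w [f [/is_omega_omega -> /bijection_app [_ [_ Hs]]]]]]; exists f => // x /Hs.
by move=> [m [Hm <-]]; exists m; split=> //; apply: (nat_in_omega Hn Hm).
Qed.

(** * Linear orders with finite initial segments *)

Section Order.

Variables (X : V) (lt : V -> V -> Prop).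
Context {Hlt : D2 lt}.
Hypothesis lt_irrefl : forall x, x ∈ X -> ~ lt x x.
Hypothesis lt_trans : forall x y z, x ∈ X -> y ∈ X -> z ∈ X -> lt x y -> lt y z -> lt x z.
Hypothesis lt_total : forall x y, x ∈ X -> y ∈ X -> lt x y \/ x = y \/ lt y x.
Hypothesis seg_finite : forall x, x ∈ X -> finite (sep X (fun y => lt y x)).

Lemma order_min (P : V -> Prop) {HP : D1 P} : (exists x, x ∈ X /\ P x) ->
  exists m, m ∈ X /\ P m /\ forall x, x ∈ X -> P x -> m = x \/ lt m x.
Proof.
move=> [x0 [Hx0 Px0]].
pose (S := sep X (fun y => P y /\ (lt y x0 \/ y = x0))).
have in_S y : y ∈ S <-> y ∈ X /\ P y /\ (lt y x0 \/ y = x0) by rewrite in_sep.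
have FS : finite S.
  apply: (finite_subset (finite_adj x0 (seg_finite Hx0))) => y.
  by rewrite in_S in_adj in_sep; tauto.
(* The candidates not above the witness [x0] form a finite set; its maximum for the converse order
   is the required minimum. *)
have [|||m [Hm Hmin]] := @finite_max _ _ (fun x y => lt y x) _ S FS.
{ by exists x0; rewrite in_S; auto. }
{ by move=> x y z /in_S [Hx _] /in_S [Hy _] /in_S [Hz _] H1 H2; apply: (lt_trans (y := y)). }
{ move=> x y /in_S [Hx _] /in_S [Hy _]; case: (lt_total Hx Hy) => [|[|]]; auto. }
case/in_S: (Hm) => HmX [Pm Hmx].
exists m; split=> //; split=> // x Hx Px.
case: (classic (x ∈ S)) => [/Hmin [->|]|HxS]; auto.
right; case: (lt_total Hx Hx0) => [H|[H|H]]; try by case: HxS; rewrite in_S; auto.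
by case: Hmx => [Hmx|->] //; apply: (lt_trans (y := x0)).
Qed.

Let next (x : V) : V :=
  the (fun y => y ∈ X /\ lt x y /\ forall z, z ∈ X -> lt x z -> y = z \/ lt y z).

Instance F1_next : F1 next.
Proof. unfold next; dfn_class. Qed.

(** Only finitely many points are not above [x], so an infinite [X] has points above [x], and by
    [order_min] a least one. *)
Lemma order_next x : ~ finite X -> x ∈ X ->
  next x ∈ X /\ lt x (next x) /\ forall z, z ∈ X -> lt x z -> next x = z \/ lt (next x) z.
Proof.
move=> Hinf Hx.
have [|y Hy] := @order_min (fun y => lt x y) _.
  apply: NNPP => Hno; apply: Hinf.
  apply: (finite_subset (finite_adj x (seg_finite Hx))) => y Hy.
  rewrite in_adj in_sep; case: (lt_total Hx Hy) => [H|[|]]; auto.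
  by case: Hno; exists y.
apply: (the_sat (P := fun y => y ∈ X /\ lt x y /\ forall z, z ∈ X -> lt x z -> y = z \/ lt y z)).
  by exists y.
move=> u v [Hu [Hxu Hmu]] [Hv [Hxv Hmv]].
case: (Hmu v Hv Hxv) => // Huv; case: (Hmv u Hu Hxu) => // Hvu.
by case: (@lt_irrefl u) => //; apply: (lt_trans (y := v)).
Qed.

(** If [X] is infinite, iterating [next] from the least point gives a strictly increasing, hence
    injective, sequence. Were a point missed, take the least missed [y] and the greatest [m] below
    it: [m] is a term of the sequence, and its successor can be neither [y] nor below [y]. *)
Lemma order_countable : countable X.
Proof.
case: (classic (finite X)) => [|Hinf]; [by left|right].
have Hnext x := @order_next x Hinf.
have [|o [Ho [_ Hmin]]] := @order_min (fun _ => True) _.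
  apply: NNPP => Hno; apply: Hinf; have -> : X = emp; last exact: finite_emp.
  by apply/is_empty_emp => x Hx; apply: Hno; exists x.
have [|f [Hf [f0 fS]]] := @recursion _ _ X o next _ Ho.
  by move=> x /Hnext [].
have fX n : n ∈ omega -> app f n ∈ X by exact: (app_in Hf).
have mono : forall n, n ∈ omega -> forall m, m ∈ n -> lt (app f m) (app f n).
  apply: omega_ind => [m /in_emp //|n Hn IH m].
  have [H1 [H2 _]] := Hnext (app f n) (fX n Hn).
  rewrite fS // in_suc => -[Hm|-> //].
  apply: (lt_trans (y := app f n)) => //; auto.
  exact: (fX m (nat_in_omega Hn Hm)).
exists omega, f; split; first by apply/is_omega_omega.
apply: app_bijection => //.
  move=> m n Hm Hn E; case: (nat_trichotomy Hn Hm) => [H|[//|H]].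
    by case: (lt_irrefl (fX n Hn)); rewrite -{1}E; apply: mono.
  by case: (lt_irrefl (fX n Hn)); rewrite -{2}E; apply: mono.
move=> x Hx; apply: NNPP => Hno.
have [|y [Hy [Py Hymin]]] := @order_min (fun y => ~ exists a, a ∈ omega /\ app f a = y) _.
  by exists x.
have Hoy : lt o y.
  case: (Hmin y Hy I) => // E; case: Py; exists emp; rewrite f0; split=> //.
  exact: emp_omega.
have [|||m [Hm Hmax]] := @finite_max _ _ lt _ _ (seg_finite Hy).
{ by exists o; rewrite in_sep. }
{ by move=> a b c; rewrite !in_sep => -[Ha _] [Hb _] [Hc _]; exact: lt_trans. }
{ by move=> a b; rewrite !in_sep => -[Ha _] [Hb _]; exact: lt_total. }
move: Hm; rewrite in_sep => -[Hm Hmy].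
have [n [Hn E]] : exists n, n ∈ omega /\ app f n = m.
  apply: NNPP => H; case: (Hymin m Hm H) => [E|H'].
    by apply: (lt_irrefl Hy); rewrite {1}E.
  by apply: (lt_irrefl Hy); apply: (lt_trans (y := m)).
have [H1 [H2 H3]] := Hnext m Hm.
case: (H3 y Hy Hmy) => [E'|H4].
  by apply: Py; exists (suc n); rewrite fS // E; split=> //; exact: suc_omega.
have := Hmax (next m); rewrite in_sep => H5.
case: (H5 (conj H1 H4)) => [E'|H6].
  by apply: (lt_irrefl Hm); rewrite {2}(eq_sym E').
by apply: (lt_irrefl Hm); apply: (lt_trans (y := next m)).
Qed.

End Order.

(** The assumed choice principle selects a linear order of every fibre at once. Comparing points
    first by [nu] and then by the order of their fibre gives a linear order of [X] with finite
    initial segments. *)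
Lemma countable_finite_fibers (X : V) (nu : V -> V) {Hnu : F1 nu} : CAC_fin V ->
  (forall x, x ∈ X -> nu x ∈ omega) ->
  (forall n, n ∈ omega -> finite (sep X (fun x => nu x = n))) -> countable X.
Proof.
move=> AC nu_nat fib_fin.
pose (E := fun n => sep X (fun x => nu x = n)).
have in_E n x : x ∈ E n <-> x ∈ X /\ nu x = n by rewrite in_sep.
have FE : F1 E by rewrite /E; exact _.
pose (U := pow (cprod X X)).
(* The orders are tagged with [n]: fibres with at most one point all have the same single order, the
   empty one, and without tags [W] would not be injective. *)
pose (W := fun n => sep (cprod (sing n) U) (fun p => linear_order (psnd p) (E n))).
have FW : F1 W by rewrite /W; exact _.
have in_W n p : p ∈ W n <-> exists L, L ∈ U /\ linear_order L (E n) /\ p = pr n L.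
  rewrite in_sep in_cprod; split.
    move=> [[a [L [/in_sing -> [HL ->]]]]]; rewrite psnd_pr => H.
    by exists L.
  move=> [L [HL [H ->]]]; rewrite psnd_pr; split=> //.
  by exists n, L; rewrite in_sing.
pose (A := sep (pow (cprod omega U)) (fun w => exists n, n ∈ omega /\ w = W n)).
have in_A w : w ∈ A <-> exists n, n ∈ omega /\ w = W n.
  rewrite in_sep; split=> [[]//|[n [Hn ->]]]; split; last by exists n.
  rewrite in_pow => p /in_W [L [HL [_ ->]]]; by rewrite pr_in_cprod.
have W_ne n : n ∈ omega -> nonempty (W n).
  move=> Hn; have [L HL] := finite_linear_order (fib_fin n Hn).
  exists (pr n L); rewrite in_W; exists L; split; last by split.
  rewrite in_pow => p /(proj1 HL) /in_cprod [a [b [/in_E [Ha _] [/in_E [Hb _] ->]]]].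
  by rewrite pr_in_cprod.
have W_fin n : n ∈ omega -> finite (W n).
  move=> Hn; pose proof (finite_pow (finite_cprod (fib_fin n Hn) (fib_fin n Hn))) as FP.
  apply: (finite_subset (finite_cprod (finite_sing n) FP)) => p /in_W [L [HL [H ->]]].
  by rewrite pr_in_cprod in_sing in_pow; split=> //; case: H.
have [||c [u [/is_union_union -> [Hc Hsel]]]] := AC A.
{ exists omega, (lam omega A W); split; first by apply/is_omega_omega.
  apply: bijection_intro.
  - by move=> n Hn; rewrite in_A; exists n.
  - move=> n m Hn Hm Enm; have [p Hp] := W_ne n Hn.
    have: p ∈ W m by rewrite -Enm.
    move: Hp; rewrite !in_W => -[L [_ [_ ->]]] [L' [_ [_ E']]].
    by case/pr_inj: E'.
  - by move=> w /in_A [n [Hn ->]]; exists n. }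
{ by move=> w /in_A [n [Hn ->]]; auto. }
pose (L := fun n => psnd (app c (W n))).
have FL : F1 L by rewrite /L; exact _.
have HL n : n ∈ omega -> linear_order (L n) (E n).
  move=> Hn; have HA : W n ∈ A by rewrite in_A; exists n.
  have: app c (W n) ∈ W n by apply: Hsel; apply: (rel_app Hc).
  by rewrite in_W => -[L' [_ [H E']]]; rewrite /L E' psnd_pr.
clearbody L; clear c Hc Hsel.
apply: (@order_countable X (fun x y => nu x ∈ nu y \/ nu x = nu y /\ pr x y ∈ L (nu x))).
- move=> x Hx [/mem_irrefl //|[_]]; by apply (proj2 (HL _ (nu_nat x Hx))).
- move=> x y z Hx Hy Hz [H1|[E1 H1]] [H2|[E2 H2]].
  + by left; apply: (nat_lt_trans (nu_nat z Hz) H1 H2).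
  + by left; rewrite -E2.
  + by left; rewrite E1.
  + right; split; first by rewrite E1.
    rewrite -E1 in H2; have [_ [_ [Ht _]]] := HL _ (nu_nat x Hx).
    by apply: Ht H1 H2.
- move=> x y Hx Hy; case: (nat_trichotomy (nu_nat y Hy) (nu_nat x Hx)) => [|[En|]]; auto.
  have [_ [_ [_ Ht]]] := HL _ (nu_nat x Hx).
  case: (Ht x y); rewrite ?in_E; auto.
  by move=> [|H]; auto; right; right; right; rewrite -En.
- move=> x Hx; have Hn := nu_nat x Hx.
  (* The points below [x] lie in the fibres over numbers at most [nu x], that is, over the members
     of [suc (nu x)]. *)
  have [n Hn'|B [HB H]] := @finite_bigcup _ _ (fun n y => y ∈ X /\ nu y = n) _ _
      (nat_finite (suc_omega Hn)).
    exists (E n); split; last by move=> y /in_E.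
    exact: fib_fin (nat_in_omega (suc_omega Hn) Hn').
  apply: (finite_subset HB) => y; rewrite in_sep => -[Hy Hyx].
  by apply: (H (nu y)) => //; rewrite in_suc; tauto.
Qed.

End Countable.

(** * Towers of closed sets *)

Section Tower.

Context {V : membership_structure} {HV : ZF V}.
Variables (X : V) (f : V -> V).
Context {Hf : F1 f}.
Hypothesis f_sub : forall S, subset (f S) S.

Definition meet (D : V) : V := sep X (fun x => forall S, S ∈ D -> x ∈ S).
#[export] Instance F1_meet : F1 meet.
Proof. unfold meet; dfn_class. Qed.

Lemma in_meet x D : x ∈ meet D <-> x ∈ X /\ forall S, S ∈ D -> x ∈ S.
Proof. by rewrite in_sep. Qed.

Definition tower_closed (M : V) : Prop :=
  X ∈ M /\ (forall S, S ∈ M -> f S ∈ M) /\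
  (forall D, subset D M -> nonempty D -> meet D ∈ M).
Instance D1_tower_closed : D1 tower_closed.
Proof. unfold tower_closed; dfn_class. Qed.

(* The Bourbaki-Witt argument, for a decreasing tower: the least closed family is
   a chain. *)
Lemma tower_exists : exists M, tower_closed M /\ (forall S, S ∈ M -> subset S X) /\
  forall S Q, S ∈ M -> Q ∈ M -> subset S Q \/ subset Q S.
Proof.
have f_sub' S x : x ∈ f S -> x ∈ S by exact: f_sub.
pose (M := sep (pow X) (fun S => forall K, tower_closed K -> S ∈ K)).
have in_M S : S ∈ M <-> subset S X /\ forall K, tower_closed K -> S ∈ K.
  by rewrite in_sep in_pow.
have meet_sub D : subset (meet D) X by move=> x; rewrite in_meet => -[].
have MC : tower_closed M.
{ split; [|split].
  - by rewrite in_M; split=> // K [].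
  - move=> S; rewrite !in_M => -[HS HK]; split; first by move=> x /f_sub' /HS.
    by move=> K HKc; case: (HKc) => _ [H _]; apply: H; apply: HK.
  - move=> D HD HDne; rewrite in_M; split=> // K HKc; case: (HKc) => _ [_ H].
    by apply: H => // S /HD; rewrite in_M => -[_]; apply. }
have M_ind K : tower_closed K -> forall S, S ∈ M -> S ∈ K.
  by move=> HK S; rewrite in_M => -[_]; apply.
have M_sub S : S ∈ M -> subset S X by rewrite in_M => -[].
clearbody M; clear in_M.
have [MX [Mf Mmeet]] := MC.
(* [S] is extreme when [f], applied to a member properly containing [S], never jumps below [S]. *)
pose (extreme := fun S => forall Q, Q ∈ M -> subset S Q -> S <> Q -> subset S (f Q)).
have De : D1 extreme by rewrite /extreme; exact _.
(* No member lies strictly between [f S] and an extreme [S], or is incomparable to both: the members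
   satisfying this alternative form a closed family, hence are all of [M]. *)
have split_at S : S ∈ M -> extreme S -> forall Q, Q ∈ M -> subset S Q \/ subset Q (f S).
{ move=> HSM HS Q HQ.
  have: Q ∈ sep M (fun Q => subset S Q \/ subset Q (f S)); last by rewrite in_sep => -[].
  apply: (M_ind _ _ Q HQ); split; [|split].
  - by rewrite in_sep; split=> //; left; apply: M_sub.
  - move=> P; rewrite !in_sep => -[HP HPS]; split; first exact: Mf.
    case: HPS => [H|H]; last by right=> x /f_sub' /H.
    case: (classic (S = P)) => [<-|Hn]; first by right.
    by left; apply: HS.
  - move=> K HK HKne; rewrite in_sep; split.
      by apply: Mmeet => // P' /HK; rewrite in_sep => -[].
    case: (classic (exists P', P' ∈ K /\ ~ subset S P')) => [[P' [HP' Hn]]|Hn].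
      right=> x; rewrite in_meet => -[_ /(_ P' HP') Hx].
      by case/in_sep: (HK P' HP') => _ [/Hn //|]; apply.
    left=> x Hx; rewrite in_meet; split; first exact: (M_sub S HSM).
    by move=> P' HP'; apply: NNPP => H; apply: Hn; exists P'; split=> // /(_ x Hx). }
exists M; split; [by []|split; first by []].
suff all_extreme : forall S, S ∈ M -> extreme S.
  move=> S Q HS HQ; case: (split_at S HS (all_extreme S HS) Q HQ) => H; auto.
  by right=> x /H /f_sub'.
(* The extreme members also form a closed family, so every member is extreme. *)
move=> S HS; have: S ∈ sep M extreme; last by rewrite in_sep => -[].
apply: (M_ind _ _ S HS); split; [|split].
- rewrite in_sep; split=> // Q HQ HXQ Hn; case: Hn.
  by apply: subset_antisym => //; apply: M_sub.
- move=> P; rewrite !in_sep => -[HP HPe]; split; first exact: Mf.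
  move=> Q HQ HPQ Hn; case: (split_at P HP HPe Q HQ) => H.
    case: (classic (P = Q)) => [<- //|HPn].
    by move=> x /f_sub' Hx; apply: (HPe Q HQ H HPn).
  by case: Hn; apply: subset_antisym.
- move=> K HK HKne; rewrite in_sep.
  have HKM : subset K M by move=> P /HK; rewrite in_sep => -[].
  split; first exact: Mmeet.
  move=> Q HQ HPQ Hn.
  (* [Q] properly contains the intersection of [K], so it is not contained in every member. Such a
     [P] must be properly contained in [Q], and extremeness of [P] gives that [f Q] contains [P],
     hence the intersection. *)
  have [P [HP HnQ]] : exists P, P ∈ K /\ ~ subset Q P.
    apply: NNPP => H; apply: Hn; apply: subset_antisym => // x Hx.
    rewrite in_meet; split; first exact: (M_sub Q HQ).
    by move=> P HP; apply: NNPP => HxP; apply: H; exists P; split=> // /(_ x Hx).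
  case/in_sep: (HK P HP) => HPM HPe.
  case: (split_at P HPM HPe Q HQ) => H; last by case: HnQ => x /H /f_sub'.
  case: (classic (P = Q)) => [E|HPQn]; first by case: HnQ; rewrite E.
  move=> x; rewrite in_meet => -[_ /(_ P HP) Hx].
  exact: (HPe Q HQ H HPQn).
Qed.

End Tower.

(** * Real numbers *)

Section Analysis.

Context {V : membership_structure} {HV : ZF V} {R : field_structure V} {HR : is_real_field R}.

Let OF : ordered_field R := proj1 HR.

Notation C := (carrier R).
Notation "0" := (zero R).
Notation "x ⊕ y" := (app2 (add R) x y) (at level 50, left associativity).
Notation "x ⊗ y" := (app2 (mul R) x y) (at level 40, left associativity).
Notation "x ≤ y" := (rel (le R) x y) (at level 70, no associativity).
Notation "x ≺ y" := (lt R x y) (at level 70, no associativity).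

#[export] Instance D2_lt : D2 (lt R).
Proof. unfold lt; dfn_class. Qed.
#[export] Instance D1_positive : D1 (positive R).
Proof. unfold positive; dfn_class. Qed.

Lemma zero_in : 0 ∈ C. Proof. exact: (of_zero _ OF). Qed.
Lemma one_in : one R ∈ C. Proof. exact: (of_one _ OF). Qed.
Lemma add_in x y : x ∈ C -> y ∈ C -> x ⊕ y ∈ C.
Proof. exact: (app2_in (of_add _ OF)). Qed.
Lemma mul_in x y : x ∈ C -> y ∈ C -> x ⊗ y ∈ C.
Proof. exact: (app2_in (of_mul _ OF)). Qed.
Local Hint Resolve zero_in one_in add_in mul_in : core.

Lemma rel2_add x y z : rel2 (add R) x y z <-> x ∈ C /\ y ∈ C /\ z = x ⊕ y.
Proof. exact: (rel2_fun _ _ _ (of_add _ OF)). Qed.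
Lemma rel2_mul x y z : rel2 (mul R) x y z <-> x ∈ C /\ y ∈ C /\ z = x ⊗ y.
Proof. exact: (rel2_fun _ _ _ (of_mul _ OF)). Qed.

Lemma addA x y z : x ∈ C -> y ∈ C -> z ∈ C -> x ⊕ y ⊕ z = x ⊕ (y ⊕ z).
Proof.
move=> Hx Hy Hz; have: rel2 (add R) x (y ⊕ z) (x ⊕ y ⊕ z).
  by apply: (of_addA _ OF x y z (x ⊕ y)); rewrite rel2_add; auto.
by rewrite rel2_add => -[_ [_ ->]].
Qed.
Lemma addC x y : x ∈ C -> y ∈ C -> x ⊕ y = y ⊕ x.
Proof.
move=> Hx Hy; have: rel2 (add R) y x (x ⊕ y) by apply: (of_addC _ OF); rewrite rel2_add; auto.
by rewrite rel2_add => -[_ [_ ->]].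
Qed.
Lemma add0 x : x ∈ C -> x ⊕ 0 = x.
Proof. by move=> /(of_add0 _ OF); rewrite rel2_add => -[_ [_ <-]]. Qed.
Lemma opp_exists x : x ∈ C -> exists y, y ∈ C /\ x ⊕ y = 0.
Proof. by move=> /(of_opp _ OF) [y [Hy]]; rewrite rel2_add => -[_ [_ E]]; exists y. Qed.
Lemma mulC x y : x ∈ C -> y ∈ C -> x ⊗ y = y ⊗ x.
Proof.
move=> Hx Hy; have: rel2 (mul R) y x (x ⊗ y) by apply: (of_mulC _ OF); rewrite rel2_mul; auto.
by rewrite rel2_mul => -[_ [_ ->]].
Qed.
Lemma mul1 x : x ∈ C -> x ⊗ one R = x.
Proof. by move=> /(of_mul1 _ OF); rewrite rel2_mul => -[_ [_ <-]]. Qed.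
Lemma mulD x y z : x ∈ C -> y ∈ C -> z ∈ C -> x ⊗ (y ⊕ z) = x ⊗ y ⊕ x ⊗ z.
Proof.
move=> Hx Hy Hz; have: rel2 (add R) (x ⊗ y) (x ⊗ z) (x ⊗ (y ⊕ z)).
  by apply: (of_mulD _ OF x y z (y ⊕ z) (x ⊗ y) (x ⊗ z));
    rewrite ?rel2_add ?rel2_mul; auto.
by rewrite rel2_add => -[_ [_ ->]].
Qed.

Lemma add_cancel x y z : x ∈ C -> y ∈ C -> z ∈ C -> x ⊕ z = y ⊕ z -> x = y.
Proof.
move=> Hx Hy Hz E; have [o [Ho Eo]] := opp_exists Hz.
by rewrite -(add0 Hx) -(add0 Hy) -Eo -!addA // E.
Qed.

Lemma le_refl x : x ∈ C -> x ≤ x. Proof. exact: (of_le_refl _ OF). Qed.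
Lemma le_antisym x y : x ∈ C -> y ∈ C -> x ≤ y -> y ≤ x -> x = y.
Proof. exact: (of_le_antisym _ OF). Qed.
Lemma le_trans y x z : x ∈ C -> y ∈ C -> z ∈ C -> x ≤ y -> y ≤ z -> x ≤ z.
Proof. by move=> Hx Hy Hz; apply: (of_le_trans _ OF). Qed.
Lemma le_total x y : x ∈ C -> y ∈ C -> x ≤ y \/ y ≤ x.
Proof. exact: (of_le_total _ OF). Qed.

Lemma lt_irrefl x : ~ x ≺ x. Proof. by case. Qed.
Lemma lt_le x y : x ≺ y -> x ≤ y. Proof. by case. Qed.
Lemma le_lt_trans y x z : x ∈ C -> y ∈ C -> z ∈ C -> x ≤ y -> y ≺ z -> x ≺ z.
Proof.
move=> Hx Hy Hz H1 [H2 Hn]; split; first exact: (@le_trans y).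
by move=> E; subst z; apply: Hn; apply: le_antisym.
Qed.
Lemma lt_le_trans y x z : x ∈ C -> y ∈ C -> z ∈ C -> x ≺ y -> y ≤ z -> x ≺ z.
Proof.
move=> Hx Hy Hz [H1 Hn] H2; split; first exact: (@le_trans y).
by move=> E; subst z; apply: Hn; apply: le_antisym.
Qed.
Lemma lt_trans y x z : x ∈ C -> y ∈ C -> z ∈ C -> x ≺ y -> y ≺ z -> x ≺ z.
Proof. by move=> Hx Hy Hz H1 /lt_le H2; apply: (@lt_le_trans y). Qed.
Lemma not_lt x y : x ∈ C -> y ∈ C -> ~ x ≺ y <-> y ≤ x.
Proof.
move=> Hx Hy; split=> [H|H1 [H2 H3]]; last by apply: H3; apply: le_antisym.
case: (le_total Hx Hy) => // Hxy; case: (classic (x = y)) => [->|Hn]; first exact: le_refl.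
by case: H.
Qed.

Lemma le_add x y z : x ∈ C -> y ∈ C -> z ∈ C -> x ≤ y -> x ⊕ z ≤ y ⊕ z.
Proof.
by move=> Hx Hy Hz H; apply: (of_le_add _ OF x y z); rewrite ?rel2_add; auto.
Qed.
Lemma lt_add x y z : x ∈ C -> y ∈ C -> z ∈ C -> x ≺ y -> x ⊕ z ≺ y ⊕ z.
Proof.
move=> Hx Hy Hz [H Hn]; split; first exact: le_add.
by move/add_cancel => E; apply: Hn; apply: E.
Qed.
Lemma lt_add2 x y z t : x ∈ C -> y ∈ C -> z ∈ C -> t ∈ C ->
  x ≺ y -> z ≺ t -> x ⊕ z ≺ y ⊕ t.
Proof.
move=> Hx Hy Hz Ht H1 H2; apply: (@lt_trans (y ⊕ z)); auto; first exact: lt_add.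
by rewrite (addC Hy Hz) (addC Hy Ht); apply: lt_add.
Qed.
Lemma le_add2 x y z t : x ∈ C -> y ∈ C -> z ∈ C -> t ∈ C ->
  x ≤ y -> z ≤ t -> x ⊕ z ≤ y ⊕ t.
Proof.
move=> Hx Hy Hz Ht H1 H2; apply: (@le_trans (y ⊕ z)); auto; first exact: le_add.
by rewrite (addC Hy Hz) (addC Hy Ht); apply: le_add.
Qed.
Lemma lt_add_l x y z : x ∈ C -> y ∈ C -> z ∈ C -> x ⊕ z ≺ y ⊕ z -> x ≺ y.
Proof.
move=> Hx Hy Hz H; apply: NNPP; rewrite not_lt // => /(le_add Hy Hx Hz).
by rewrite -not_lt; auto.
Qed.
Lemma le_add_nonneg x y : x ∈ C -> y ∈ C -> 0 ≤ y -> x ≤ x ⊕ y.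
Proof.
move=> Hx Hy H; rewrite -{1}(add0 Hx); apply: le_add2; auto; exact: le_refl.
Qed.

Lemma sub_exists x y : x ∈ C -> y ∈ C -> x ≺ y -> exists z, positive R z /\ x ⊕ z = y.
Proof.
move=> Hx Hy Hxy; have [o [Ho Eo]] := opp_exists Hx.
have E : x ⊕ (y ⊕ o) = y by rewrite (addC Hy Ho) -addA // Eo addC // add0.
exists (y ⊕ o); split=> //; split; auto.
apply: (@lt_add_l _ _ x); auto.
by rewrite (@addC 0) // add0 // (@addC _ x) ?E; auto.
Qed.

Lemma mul0 x : x ∈ C -> x ⊗ 0 = 0.
Proof.
move=> Hx; apply: (@add_cancel _ _ (x ⊗ 0)); auto.
by rewrite -mulD // add0 // addC ?add0; auto.
Qed.

(** If one were at most zero, its opposite [m] would be nonnegative, and so would the square of [m],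
    which is one. *)
Lemma one_positive : positive R (one R).
Proof.
split; first exact: one_in; split; last exact: (of_zero_neq_one _ OF).
case: (le_total zero_in one_in) => // H; have [m [Hm Em]] := opp_exists one_in.
have Hm0 : 0 ≤ m.
  have := @le_add _ _ m one_in zero_in Hm H; by rewrite Em addC // add0.
have E : m ⊗ m = one R.
  apply: (@add_cancel _ _ m); auto.
  by rewrite -{3}(mul1 Hm) -mulD // (@addC m) // Em mul0.
by rewrite -E; apply: (of_le_mul _ OF m m); rewrite ?rel2_mul.
Qed.

Definition half (x : V) : V := the (fun y => y ∈ C /\ y ⊕ y = x).
#[export] Instance F1_half : F1 half.
Proof. unfold half; dfn_class. Qed.

Lemma double_lt x y : x ∈ C -> y ∈ C -> x ≺ y -> x ⊕ x ≺ y ⊕ y.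
Proof. by move=> Hx Hy H; apply: lt_add2. Qed.

Lemma double_inj x y : x ∈ C -> y ∈ C -> x ⊕ x = y ⊕ y -> x = y.
Proof.
move=> Hx Hy E; apply: le_antisym => //; apply/not_lt => // /double_lt;
by rewrite E => H; apply: lt_irrefl (H _ _).
Qed.

Lemma half_spec x : x ∈ C -> half x ∈ C /\ half x ⊕ half x = x.
Proof.
move=> Hx; apply: (the_sat (P := fun y => y ∈ C /\ y ⊕ y = x)); last first.
  by move=> y z [Hy Ey] [Hz Ez]; apply: double_inj => //; rewrite Ey.
have H2 : one R ⊕ one R <> 0.
  have [_ H1] := one_positive; move=> E.
  have := double_lt zero_in one_in H1; rewrite E add0 //; exact: lt_irrefl.
have [i [Hi]] := of_inv _ OF _ (add_in one_in one_in) H2.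
rewrite rel2_mul => -[_ [_ Ei]].
exists (x ⊗ i); split; auto.
rewrite -mulD // -{1 2}(mul1 Hi) -mulD // (@mulC i); auto.
by rewrite -Ei mul1.
Qed.

Lemma half_positive x : positive R x -> positive R (half x).
Proof.
move=> [Hx Hpos]; have [Hh E] := half_spec Hx; split=> //.
apply: NNPP; rewrite not_lt // => H.
suff: x ≤ 0 by rewrite -not_lt.
by rewrite -E -(add0 zero_in); apply: le_add2.
Qed.

Lemma half_lt x : positive R x -> half x ≺ x.
Proof.
move=> Hx; have [Hh Hpos] := half_positive Hx; have [_ E] := half_spec (proj1 Hx).
rewrite -{2}E -{1}(add0 Hh) (addC Hh) // ; apply: lt_add => //.
Qed.

Lemma geometric_exists : exists h, is_fun h omega C /\ app h emp = one R /\
  forall n, n ∈ omega -> app h (suc n) = half (app h n).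
Proof. by apply: recursion => // x /half_spec []. Qed.

(** [epsilon] fixes one element of the model; from then on it is a parameter, so that [pow2] is
    definable. *)
Definition geom : V := epsilon dom_inhabited (fun h => is_fun h omega C /\ app h emp = one R /\
  forall n, n ∈ omega -> app h (suc n) = half (app h n)).

(** This is 2^(-n): the sequence starts at one and is halved at every step. *)
Definition pow2 (n : V) : V := app geom n.
#[export] Instance F1_pow2 : F1 pow2.
Proof. unfold pow2; dfn_class. Qed.

Lemma geom_spec : is_fun geom omega C /\ app geom emp = one R /\
  forall n, n ∈ omega -> app geom (suc n) = half (app geom n).
Proof. exact: (epsilon_spec _ _ geometric_exists). Qed.

Lemma pow2_positive n : n ∈ omega -> positive R (pow2 n).
Proof.
have [Hf [f0 fS]] := geom_spec.
move: n; apply: omega_ind; first by rewrite /pow2 f0; exact: one_positive.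
by move=> n Hn IH; rewrite /pow2 fS //; apply: half_positive.
Qed.

Lemma pow2_in n : n ∈ omega -> pow2 n ∈ C.
Proof. by case/pow2_positive. Qed.
Local Hint Resolve pow2_in : core.

Lemma pow2_suc n : n ∈ omega -> pow2 (suc n) ⊕ pow2 (suc n) = pow2 n.
Proof.
move=> Hn; have [_ [_ fS]] := geom_spec.
by rewrite {1 2}/pow2 fS //; apply: (proj2 (half_spec _)); auto.
Qed.

Lemma pow2_decreasing n : n ∈ omega -> forall m, m ∈ n -> pow2 n ≺ pow2 m.
Proof.
move: n; apply: omega_ind => [m /in_emp //|n Hn IH m].
have H : pow2 (suc n) ≺ pow2 n.
  by have [_ [_ fS]] := geom_spec; rewrite /pow2 fS //; apply: half_lt; exact: pow2_positive.
rewrite in_suc => -[Hm|-> //].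
have Hm' := nat_in_omega Hn Hm.
by apply: (@lt_trans (pow2 n)); auto; apply: pow2_in; exact: suc_omega.
Qed.

(** The Archimedean property from completeness. Otherwise the lower bounds of all 2^(-n) have a
    supremum [L] with [e ≤ L]; since [L] is below every 2^(-n-1), its double is again such a lower
    bound, so [L ⊕ L ≤ L], contradicting positivity. *)
Lemma pow2_small e : positive R e -> exists n, n ∈ omega /\ pow2 n ≺ e.
Proof.
move=> [He Hpos]; apply: NNPP => Hno.
have Hle n : n ∈ omega -> e ≤ pow2 n.
  by move=> Hn; apply/not_lt; auto; move=> H; apply: Hno; exists n.
pose (S := sep C (fun x => forall n, n ∈ omega -> x ≤ pow2 n)).
have in_S x : x ∈ S <-> x ∈ C /\ forall n, n ∈ omega -> x ≤ pow2 n by rewrite in_sep.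
have [|||L [[HL Hub] Hmin]] := proj2 HR S.
{ by move=> x /in_S []. }
{ by exists e; rewrite in_S. }
{ exists (pow2 emp); split; first exact: (pow2_in emp_omega).
  by move=> x /in_S [_]; apply; exact: emp_omega. }
have HLn n : n ∈ omega -> L ≤ pow2 n.
  by move=> Hn; apply: Hmin; split; auto; move=> x /in_S [_]; apply.
have H2 : L ⊕ L ≤ L.
  apply: Hub; rewrite in_S; split; auto => n Hn; rewrite -(pow2_suc Hn).
  by have Hs := suc_omega Hn; apply: le_add2; auto.
have H3 : e ≤ L by apply: Hub; rewrite in_S.
have H4 : 0 ≺ L by apply: (@lt_le_trans e).
by move: H2; rewrite -not_lt; auto; apply; rewrite -{1}(add0 HL) (addC HL) //; apply: lt_add.
Qed.

(** * Metric spaces *)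

Section Metric.

Definition ball (X d x e : V) : V := sep X (fun y => app2 d x y ≺ e).
#[export] Instance F2_ball X d : F2 (ball X d).
Proof. unfold ball; dfn_class. Qed.

Lemma in_ball X d x e y : y ∈ ball X d x e <-> y ∈ X /\ app2 d x y ≺ e.
Proof. by rewrite in_sep. Qed.

#[export] Instance D4_closer : D4 (closer R).
Proof. unfold closer; dfn_class. Qed.

Variables (X d : V).
Hypothesis Hd : metric R X d.

Notation dist := (app2 d).

Lemma rel2_dist x y r : rel2 d x y r <-> x ∈ X /\ y ∈ X /\ r = dist x y.
Proof. exact: (rel2_fun _ _ _ (proj1 Hd)). Qed.

Lemma dist_in x y : x ∈ X -> y ∈ X -> dist x y ∈ C.
Proof. exact: (app2_in (proj1 Hd)). Qed.
Local Hint Resolve dist_in : core.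

Lemma dist_eq0 x y : x ∈ X -> y ∈ X -> dist x y = 0 <-> x = y.
Proof.
move=> Hx Hy; have [_ [_ [H _]]] := Hd; rewrite -(H x y) // rel2_dist.
by split=> [->|[_ [_]]].
Qed.

Lemma dist_refl x : x ∈ X -> dist x x = 0.
Proof. by move=> Hx; apply/dist_eq0. Qed.

Lemma dist_sym x y : x ∈ X -> y ∈ X -> dist x y = dist y x.
Proof.
move=> Hx Hy; have [_ [_ [_ [H _]]]] := Hd.
have: rel2 d y x (dist x y) by apply: H; rewrite rel2_dist.
by rewrite rel2_dist => -[_ [_]].
Qed.

Lemma dist_triangle y x z : x ∈ X -> y ∈ X -> z ∈ X -> dist x z ≤ dist x y ⊕ dist y z.
Proof.
move=> Hx Hy Hz; have [_ [_ [_ [_ H]]]] := Hd.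
by apply: (H x y z (dist x y) (dist y z)); rewrite ?rel2_dist ?rel2_add; auto.
Qed.

Lemma dist_lt_add y x z a b : x ∈ X -> y ∈ X -> z ∈ X -> a ∈ C -> b ∈ C ->
  dist x y ≺ a -> dist y z ≺ b -> dist x z ≺ a ⊕ b.
Proof.
move=> Hx Hy Hz Ha Hb H1 H2; apply: (le_lt_trans (y := dist x y ⊕ dist y z)); auto.
  exact: dist_triangle.
by apply: lt_add2; auto.
Qed.

Lemma closerE x y e : closer R d x y e <-> x ∈ X /\ y ∈ X /\ dist x y ≺ e.
Proof.
split=> [[r []]|[Hx [Hy H]]]; first by rewrite rel2_dist => -[Hx [Hy ->]].
by exists (dist x y); rewrite rel2_dist.
Qed.

Lemma is_ballE B x e : x ∈ X -> is_ball R X d B x e <-> B = ball X d x e.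
Proof.
move=> Hx; split=> [H|-> y]; last by rewrite in_ball closerE; tauto.
by apply: ext_eq => y; rewrite in_ball (H y) closerE; tauto.
Qed.

Lemma ball_center x e : x ∈ X -> positive R e -> x ∈ ball X d x e.
Proof. by move=> Hx [_ He]; rewrite in_ball dist_refl. Qed.

Lemma ball_subset x e : subset (ball X d x e) X.
Proof. by move=> y; rewrite in_ball => -[]. Qed.

(** Radii 2^(-n) suffice by the Archimedean property. A radius is then given by a number, and a
    least one can be taken without choice. *)
Definition metric_open (U : V) : Prop :=
  subset U X /\ forall x, x ∈ U -> exists n, n ∈ omega /\ subset (ball X d x (pow2 n)) U.
#[export] Instance D1_metric_open : D1 metric_open.
Proof. unfold metric_open; dfn_class. Qed.

Lemma ball_mono x a b : x ∈ X -> a ∈ C -> b ∈ C -> a ≤ b ->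
  subset (ball X d x a) (ball X d x b).
Proof.
move=> Hx Ha Hb Hab y; rewrite !in_ball => -[Hy H]; split=> //.
by apply: (lt_le_trans (y := a)); auto.
Qed.

Lemma metric_openP U : metric_open U <-> subset U X /\
  forall x, x ∈ U -> exists e B, positive R e /\ is_ball R X d B x e /\ subset B U.
Proof.
split=> -[HU H]; split=> // x Hx; have HxX := HU x Hx.
  have [n [Hn Hb]] := H x Hx; exists (pow2 n), (ball X d x (pow2 n)).
  split; first exact: pow2_positive.
  by split=> //; apply/is_ballE.
have [e [B [He [/(is_ballE _ _ HxX) -> HB]]]] := H x Hx.
have [n [Hn Hlt]] := pow2_small He; exists n; split=> // y Hy; apply: HB.
by apply: ball_mono Hy; auto; [case: He|apply: lt_le].
Qed.

Lemma metric_topologyP T : metric_topology R X d T <-> forall U, U ∈ T <-> metric_open U.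
Proof. by split=> H U; rewrite (H U) metric_openP. Qed.

Lemma metric_topology_exists : exists T, metric_topology R X d T.
Proof.
exists (sep (pow X) metric_open); apply/metric_topologyP => U.
by rewrite in_sep in_pow; split=> [[]|H] //; split=> //; case: H.
Qed.

Lemma open_ball x e : x ∈ X -> e ∈ C -> metric_open (ball X d x e).
Proof.
move=> Hx He; split; first exact: ball_subset.
move=> y; rewrite in_ball => -[Hy Hlt].
have [|r [Hr E]] := sub_exists _ He Hlt; auto.
have [n [Hn Hn']] := pow2_small Hr; exists n; split=> // z; rewrite !in_ball => -[Hz Hyz].
split=> //; have HrC : r ∈ C by case: Hr.
rewrite -E; apply: (le_lt_trans (y := dist x y ⊕ dist y z)); auto; first exact: dist_triangle.
rewrite (addC (y := dist y z)) 1?(addC (y := r)); auto.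
by apply: lt_add; auto; apply: (lt_trans (y := pow2 n)); auto.
Qed.

End Metric.

(** * Total boundedness, scatteredness and compactness *)

Section Compactness.

Variables (X d : V).
Hypothesis Hd : metric R X d.
Notation dist := (app2 d).
Let dist_inX x y : x ∈ X -> y ∈ X -> dist x y ∈ C := fun hx hy => dist_in Hd hx hy.
Local Hint Resolve dist_inX : core.

Lemma metric_topology_topology T : metric_topology R X d T -> topology X T.
Proof.
move=> /(metric_topologyP Hd) HT; split; [|split; [|split]].
- by move=> U /HT [].
- rewrite HT; split=> // x Hx; exists emp; split; first exact: emp_omega.
  exact: ball_subset.
- move=> K U HK HU; rewrite HT; split.
    by move=> x /HU [W [/HK /HT [H _] /H]].
  move=> x /HU [W [HW Hx]]; have [_ H] := proj1 (HT W) (HK W HW).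
  have [n [Hn Hb]] := H x Hx; exists n; split=> // y /Hb Hy.
  by rewrite (HU y); exists W.
- move=> A B K; rewrite !HT => -[HA HA'] [HB HB'] HK; split.
    by move=> x /HK [/HA].
  move=> x /HK [HxA HxB]; have HxX := HA x HxA.
  have [n [Hn Hbn]] := HA' x HxA; have [m [Hm Hbm]] := HB' x HxB.
  have mono k l : k ∈ omega -> l ∈ omega -> l ∈ k \/ l = k ->
      subset (ball X d x (pow2 k)) (ball X d x (pow2 l)).
    move=> Hk Hl Hlk; apply: (ball_mono Hd); auto.
    by case: Hlk => [/(pow2_decreasing Hk) /lt_le|->] //; apply: le_refl; auto.
  case: (nat_trichotomy Hn Hm) => [H|[H|H]].
  + exists n; split=> // y Hy; rewrite (HK y); split; first exact: Hbn.
    by apply: Hbm; apply: mono Hy; auto.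
  + exists n; split=> // y Hy; rewrite (HK y); split; first exact: Hbn.
    by apply: Hbm; apply: mono Hy; auto.
  + exists m; split=> // y Hy; rewrite (HK y); split; last exact: Hbm.
    by apply: Hbn; apply: mono Hy; auto.
Qed.

Lemma totally_boundedP : totally_bounded R X d <->
  forall e, positive R e -> exists F, subset F X /\ finite F /\
    forall y, y ∈ X -> exists x, x ∈ F /\ dist x y ≺ e.
Proof.
split=> H e He; have [F [HF [FF Hnet]]] := H e He; exists F; split=> //; split=> // y Hy.
  have [x [B [Hx [/(is_ballE Hd _ _ (HF x Hx)) -> ]]]] := Hnet y Hy.
  by rewrite in_ball => -[_ Hxy]; exists x.
have [x [Hx Hxy]] := Hnet y Hy; exists x, (ball X d x e); split=> //.
by rewrite (is_ballE Hd) ?in_ball; auto.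
Qed.

(** Take a finite net of radius 2^(-n-1). Two points of [A] near the same centre are closer than
    2^(-n), hence equal, so each centre serves at most one point. *)
Lemma separated_finite A n : totally_bounded R X d -> subset A X -> n ∈ omega ->
  (forall x y, x ∈ A -> y ∈ A -> dist x y ≺ pow2 n -> x = y) -> finite A.
Proof.
move=> /totally_boundedP Htb HA Hn Hsep; have HSn := suc_omega Hn.
have [F [HF [FF Hnet]]] := Htb _ (pow2_positive HSn).
apply: (@finite_of_injective_relation _ _ (fun x c => c ∈ X /\ dist c x ≺ pow2 (suc n)) _ A F FF).
  by move=> x /HA /Hnet [c [Hc H]]; exists c; auto.
move=> x y c Hx Hy [HcX Hcx] [_ Hcy].
apply: Hsep => //; rewrite -(pow2_suc Hn); apply: (dist_lt_add Hd (y := c)); auto.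
by rewrite (dist_sym Hd); auto.
Qed.

Lemma scattered_isolated T : metric_topology R X d T -> scattered X T ->
  forall S, subset S X -> nonempty S -> exists x, x ∈ S /\
    exists n, n ∈ omega /\ forall y, y ∈ S -> dist x y ≺ pow2 n -> y = x.
Proof.
move=> /(metric_topologyP Hd) HT Hsc S HS /(Hsc S HS) [x [Hx [U [/HT [_ HU] HUx]]]].
exists x; split=> //.
have [n [Hn Hb]] := HU x (proj1 (proj2 (HUx x) (eq_refl x))).
exists n; split=> // y Hy Hxy; apply/HUx; split=> //; apply: Hb.
by rewrite in_ball; auto.
Qed.

Lemma scattered_countable T : CAC_fin V -> metric_topology R X d T ->
  totally_bounded R X d -> scattered X T -> countable X.
Proof.
move=> AC HT Htb Hsc; have Hiso := scattered_isolated HT Hsc.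
pose (iso_at := fun S x n => forall y, y ∈ S -> dist x y ≺ pow2 n -> y = x).
have D_iso : D3 iso_at by rewrite /iso_at; exact _.
(* The Cantor-Bendixson derivative. The tower below replaces its transfinite iteration, so that no
   ordinals are needed. *)
pose (der := fun S => sep S (fun x => ~ exists n, n ∈ omega /\ iso_at S x n)).
have F_der : F1 der by rewrite /der; exact _.
have [|M [[MX [Mder Mmeet]] [Msub chain]]] := @tower_exists _ _ X der _.
  by move=> S x; rewrite in_sep => -[].
pose (c := fun x => meet X (sep M (fun S => x ∈ S))).
have F_c : F1 c by rewrite /c; exact _.
have in_c x y : x ∈ X -> y ∈ c x <-> forall S, S ∈ M -> x ∈ S -> y ∈ S.
  move=> Hx; rewrite in_meet; split.
    by move=> [_ H] S HS HxS; apply: H; rewrite in_sep.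
  by move=> H; split; [apply: H|move=> S; rewrite in_sep => -[]; auto].
have c_self x : x ∈ X -> x ∈ c x by move=> Hx; apply/in_c.
have cM x : x ∈ X -> c x ∈ M.
  move=> Hx; apply: Mmeet; first by move=> S; rewrite in_sep => -[].
  by exists X; rewrite in_sep.
have c_iso x : x ∈ X -> exists n, n ∈ omega /\ iso_at (c x) x n.
  (* If [x] were not isolated in [c x], it would belong to [der (c x)], a member of the tower; by
     minimality [c x] would then be contained in its own derivative and have no isolated point,
     contrary to scatteredness. *)
  move=> Hx; apply: NNPP => Hno.
  have Hxd : x ∈ der (c x) by rewrite in_sep; split; auto.
  have [|y [Hy Hyi]] := Hiso (c x) (Msub _ (cM x Hx)); first by exists x; auto.
  have: y ∈ der (c x) by apply: (proj1 (in_c x y Hx) Hy) => //; apply: Mder; auto.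
  by rewrite in_sep => -[].
pose (nu := fun x => least omega (fun n => iso_at (c x) x n)).
have F_nu : F1 nu by rewrite /nu; exact _.
have nu_spec x : x ∈ X -> nu x ∈ omega /\ iso_at (c x) x (nu x).
  by move=> /c_iso /least_spec [H1 [H2 _]].
apply: (@countable_finite_fibers _ _ X nu) => //; first by move=> x /nu_spec [].
move=> n Hn; apply: (separated_finite (n := n)) => //.
  by move=> x; rewrite in_sep => -[].
move=> x y; rewrite !in_sep => -[Hx Ex] [Hy Ey] Hxy.
have [_ Ix] := nu_spec x Hx; have [_ Iy] := nu_spec y Hy.
case: (chain (c x) (c y)); auto => H.
  by apply: Iy; [apply: H; auto|rewrite (dist_sym Hd) // Ey].
by symmetry; apply: Ix; [apply: H; auto|rewrite Ex].
Qed.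

Lemma compact_totally_bounded T : metric_topology R X d T -> compact X T ->
  totally_bounded R X d.
Proof.
move=> /(metric_topologyP Hd) HT Hcpt; apply/totally_boundedP => e He.
have HeC : e ∈ C by case: He.
pose (K := sep T (fun B => exists x, x ∈ X /\ B = ball X d x e)).
have [|D [HDK [FD [_ Hcov]]]] := Hcpt K.
  split; first by move=> B; rewrite in_sep => -[].
  move=> x Hx; exists (ball X d x e); split; last exact: (ball_center Hd).
  rewrite in_sep HT; split; first exact: (open_ball Hd).
  by exists x.
(* The sets of the subcover come without distinguished centres; one for each is obtained by finite
   selection. *)
have [|F [FF [HF Hsel]]] := @finite_selection _ _ (fun B x => B = ball X d x e) _ X D FD.
  by move=> B /HDK; rewrite in_sep => -[].
exists F; split=> //; split=> // y /Hcov [U [HU HyU]].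
have [x [Hx E]] := Hsel U HU; exists x; split=> //.
by move: HyU; rewrite E in_ball => -[].
Qed.

(** Suppose the cover [K] has no finite subcover, and call a set small when finitely many members of
    [K] cover it. Starting from [X], intersect successively with balls of radius 2^(-n) so that the
    sets [B n] never become small. Points picked from them form a Cauchy sequence; a member of [K]
    around its limit contains some [B m], which is thereby small. Every pick is the first suitable
    entry of the enumeration [en]. *)
Lemma complete_countable_compact T : metric_topology R X d T ->
  totally_bounded R X d -> complete R X d -> countable X -> compact X T.
Proof.
move=> /(metric_topologyP Hd) HT /totally_boundedP Htb Hcomp /countable_enumeration [en Hen].
move=> K [HKT HKX]; apply: NNPP => Hno.
pose (small := fun S =>
  exists D, subset D K /\ finite D /\ forall x, x ∈ S -> exists U, U ∈ D /\ x ∈ U).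
have D_small : D1 small by rewrite /small; exact _.
have X_large : ~ small X.
  move=> [D [HDK [FD Hcov]]]; apply: Hno; exists D; split=> //; split=> //; split=> //.
  by move=> U /HDK /HKT.
pose (idx := fun x => least omega (fun m => app en m = x)).
have F_idx : F1 idx by rewrite /idx; exact _.
have idx_spec x : x ∈ X -> idx x ∈ omega /\ app en (idx x) = x.
  by move=> /Hen /least_spec [H1 [H2 _]].
pose (pick := fun P => app en (least omega (fun m => app en m ∈ P))).
have F_pick : F1 pick by rewrite /pick; exact _.
have pick_in P : subset P X -> nonempty P -> pick P ∈ P.
  move=> HP [x Hx]; have [m [Hm E]] := Hen x (HP x Hx).
  have [|_ [H _]] := @least_spec _ _ (fun m => app en m ∈ P) _; last exact: H.
  by exists m; rewrite E.
pose (centre := fun n S => pick (sep X (fun x => ~ small (sep S (fun y => dist x y ≺ pow2 n))))).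
have F_centre : F2 centre by rewrite /centre; exact _.
pose (cut := fun n S => sep S (fun y => dist (centre n S) y ≺ pow2 n)).
have F_cut : F2 cut by rewrite /cut; exact _.
have cut_large n S : n ∈ omega -> subset S X -> ~ small S ->
    centre n S ∈ X /\ ~ small (cut n S).
  move=> Hn HS HnS.
  (* Some centre works: if all balls met [S] in small sets, then uniting the covers over a finite
     net, by induction on the net, would make [S] small. *)
  pose (Q := fun x => ~ small (sep S (fun y => dist x y ≺ pow2 n))).
  have DQ : D1 Q by rewrite /Q; exact _.
  have HQ : nonempty (sep X Q).
    apply: NNPP => Hall; apply: HnS.
    have [F [HF [FF Hnet]]] := Htb _ (pow2_positive Hn).
    have H : forall G, finite G -> subset G X ->
        small (sep S (fun y => exists x, x ∈ G /\ dist x y ≺ pow2 n)).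
      apply: finite_ind.
        move=> _; exists emp; split; first by move=> x /in_emp.
        split; first exact: finite_emp.
        by move=> x; rewrite in_sep => -[_ [y [/in_emp]]].
      move=> G x FG _ IH HG.
      have [|D [HDK [FD HD]]] := IH; first by move=> y Hy; apply: HG; rewrite in_adj; left.
      have HxX : x ∈ X by apply: HG; rewrite in_adj; right.
      have [D' [HDK' [FD' HD']]] : small (sep S (fun y => dist x y ≺ pow2 n)).
        by apply: NNPP => Hx; apply: Hall; exists x; rewrite in_sep.
      exists (cup D D'); split; first by move=> U; rewrite in_cup => -[/HDK|/HDK'].
      split; first exact: finite_cup.
      move=> y; rewrite in_sep => -[Hy [z [Hz Hzy]]]; move: Hz; rewrite in_adj => -[Hz|E].
        have [|U [HU HyU]] := HD y; first by rewrite in_sep; split=> //; exists z.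
        by exists U; rewrite in_cup; auto.
      have [|U [HU HyU]] := HD' y; first by rewrite in_sep -E.
      by exists U; rewrite in_cup; auto.
    have [D [HDK [FD HD]]] := H F FF HF; exists D; split=> //; split=> // y Hy.
    by apply: HD; rewrite in_sep; split=> //; apply: Hnet; apply: HS.
  have: centre n S ∈ sep X Q by apply: pick_in => // x; rewrite in_sep => -[].
  by rewrite in_sep.
(* [recursion] iterates a unary map, so the stage number is carried along in a pair with the current
   set. *)
pose (step := fun p => pr (suc (pfst p)) (cut (pfst p) (psnd p))).
have F_step : F1 step by rewrite /step; exact _.
have [||s [Hs [s0 sS]]] := @recursion _ _ (cprod omega (pow X)) (pr emp X) step _.
{ by rewrite pr_in_cprod in_pow; split=> //; exact: emp_omega. }
{ move=> p /in_cprod [n [S [Hn [/in_pow HS ->]]]].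
  rewrite /step pfst_pr psnd_pr pr_in_cprod in_pow; split; first exact: suc_omega.
  by move=> x; rewrite in_sep => -[/HS]. }
pose (B := fun n => psnd (app s n)).
have F_B : F1 B by rewrite /B; exact _.
have s_pair : forall n, n ∈ omega -> app s n = pr n (B n).
  apply: omega_ind; first by rewrite /B s0 psnd_pr.
  by move=> n Hn IH; rewrite /B sS // IH /step pfst_pr !psnd_pr.
have B0 : B emp = X by rewrite /B s0 psnd_pr.
have BS n : n ∈ omega -> B (suc n) = cut n (B n).
  by move=> Hn; rewrite {1}/B sS // s_pair // /step pfst_pr !psnd_pr.
clearbody B; clear s Hs s0 sS s_pair.
have B_large : forall n, n ∈ omega -> subset (B n) X /\ ~ small (B n).
  apply: omega_ind; first by rewrite B0; split=> // x.
  move=> n Hn [IH1 IH2]; rewrite BS //; split; last by case: (cut_large n (B n)).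
  by move=> x; rewrite in_sep => -[/IH1].
have B_mono : forall n, n ∈ omega -> forall m, m ∈ n -> subset (B n) (B m).
  apply: omega_ind => [m /in_emp //|n Hn IH m].
  have H : subset (B (suc n)) (B n) by rewrite BS // => x; rewrite in_sep => -[].
  by rewrite in_suc => -[Hm|-> //] x /H; apply: IH.
(* [B (suc (suc n))] was cut out of [B (suc n)] by a ball of radius 2^(-n-1); two of its points are
   therefore closer than 2^(-n). *)
have B_close n x y : n ∈ omega -> x ∈ B (suc (suc n)) -> y ∈ B (suc (suc n)) ->
    dist x y ≺ pow2 n.
  move=> Hn; have Hn' := suc_omega Hn; have [HB HBl] := B_large _ Hn'.
  have [Hc _] := cut_large _ _ Hn' HB HBl.
  rewrite BS // !in_sep => -[/HB Hx Hcx] [/HB Hy Hcy].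
  rewrite -(pow2_suc Hn); apply: (dist_lt_add Hd (y := centre (suc n) (B (suc n)))); auto.
  by rewrite (dist_sym Hd).
have B_pick n : n ∈ omega -> pick (B n) ∈ B n.
  move=> Hn; have [HB HBl] := B_large n Hn; apply: pick_in => //.
  apply: NNPP => He; apply: HBl; exists emp; split; first by move=> x /in_emp.
  split; first exact: finite_emp.
  by move=> x Hx; case: He; exists x.
have pX n : n ∈ omega -> pick (B n) ∈ X.
  by move=> Hn; have [HB _] := B_large n Hn; apply: HB; apply: B_pick.
pose (s := lam omega X (fun n => pick (B n))).
have B_le m n : n ∈ omega -> nat_le m n -> subset (B n) (B m).
  by move=> Hn [/(B_mono n Hn)|->].
have nat_le_omega N n : rel s n N -> n ∈ omega by rewrite rel_lam => -[].
have [||l [Hl Hconv]] := Hcomp s.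
{ by exists omega; split; [apply/is_omega_omega|apply: lam_fun]. }
{ move=> e He; have [n [Hn Hne]] := pow2_small He.
  exists (suc (suc n)); split; first by apply/in_omega; do 2 apply: suc_omega.
  move=> k m x y Hk Hm; rewrite !rel_lam => -[Hko [_ ->]] [Hmo [_ ->]].
  rewrite (closerE Hd); split; [|split]; auto.
  have HeC : e ∈ C by case: He.
  apply: (lt_trans (y := pow2 n)); auto.
  by apply: B_close => //; [apply: (B_le _ k)|apply: (B_le _ m)]; auto. }
have [U [HU HlU]] := HKX l Hl.
have [HUX /(_ l HlU) [n [Hn Hb]]] := proj1 (HT U) (HKT U HU).
have Hn' := suc_omega Hn.
have [N [/in_omega HN HN']] := Hconv _ (pow2_positive Hn').
(* From stage n+3 on, points of [B m] are within 2^(-n-1) of the picked point, which for large [m]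
   is within 2^(-n-1) of the limit. So [B m] lies in the ball of radius 2^(-n), hence in [U]. *)
pose (k := suc (suc (suc n))).
have Hk : k ∈ omega by do 2 apply: suc_omega.
have [m [Hm [HNm Hkm]]] : exists m, m ∈ omega /\ nat_le N m /\ nat_le k m.
  case: (nat_trichotomy HN Hk) => [H|[<-|H]].
    by exists N; rewrite /nat_le; auto.
    by exists k; rewrite /nat_le; auto.
  by exists k; rewrite /nat_le; auto.
have [_] := B_large m Hm; apply; exists (sing U).
split; first by move=> W; rewrite in_sing => ->.
split; first exact: finite_sing.
move=> y Hy; exists U; rewrite in_sing; split=> //; apply: Hb; rewrite in_ball.
have HyX : y ∈ X by have [HB _] := B_large m Hm; exact: HB.
split=> //; rewrite -(pow2_suc Hn); apply: (dist_lt_add Hd (y := pick (B m))); auto.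
  have: closer R d (pick (B m)) l (pow2 (suc n)) by apply: (HN' m) => //; rewrite rel_lam; auto.
  by rewrite (closerE Hd) (dist_sym Hd); auto; case=> _ [].
by apply: B_close => //; apply: (B_le _ m); auto.
Qed.

End Compactness.

(** * Ultrametrics defined by a null function *)

Section NullSpace.

Definition rmax (x y : V) : V := the (fun r => x ≤ y /\ r = y \/ y ≤ x /\ r = x).
#[export] Instance F2_rmax : F2 rmax.
Proof. unfold rmax; dfn_class. Qed.

Lemma rmax_spec x y : x ∈ C -> y ∈ C ->
  x ≤ rmax x y /\ y ≤ rmax x y /\ (rmax x y = x \/ rmax x y = y).
Proof.
move=> Hx Hy.
have: x ≤ y /\ rmax x y = y \/ y ≤ x /\ rmax x y = x.
  apply: (the_sat (P := fun r => x ≤ y /\ r = y \/ y ≤ x /\ r = x)).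
    by case: (le_total Hx Hy); [exists y|exists x]; auto.
  by move=> u v [[H1 ->]|[H1 ->]] [[H2 ->]|[H2 ->]] //; apply: le_antisym.
by move=> [[H ->]|[H ->]]; split; auto; (try split); auto; apply: le_refl.
Qed.

Lemma rmax_in x y : x ∈ C -> y ∈ C -> rmax x y ∈ C.
Proof. by move=> Hx Hy; case: (rmax_spec Hx Hy) => _ [_ [->|->]]. Qed.
Local Hint Resolve rmax_in : core.

Variables (X : V) (rho : V -> V).
Context {Frho : F1 rho}.
Hypothesis rho_in : forall x, x ∈ X -> rho x ∈ C.
Hypothesis rho_nonneg : forall x, x ∈ X -> 0 ≤ rho x.
Hypothesis rho_inj0 : forall x y, x ∈ X -> y ∈ X -> rho x = 0 -> rho y = 0 -> x = y.
Local Hint Resolve rho_in rho_nonneg : core.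

(** With [rho] nonnegative and vanishing at most once, this yields an ultrametric. The ball of
    radius [rho x] around [x] contains only [x] when [rho x] is nonzero; a zero of [rho] is the only
    possible limit point. *)
Definition null_dist (d : V) : Prop :=
  forall x y, x ∈ X -> y ∈ X -> x <> y -> app2 d x y = rmax (rho x) (rho y).

Lemma null_metric_exists : exists d, metric R X d /\ null_dist d.
Proof.
pose (dd := fun x y => the (fun r => x = y /\ r = 0 \/ x <> y /\ r = rmax (rho x) (rho y))).
have F_dd : F2 dd by rewrite /dd; exact _.
have dd_refl x : dd x x = 0.
  by apply: the_eq => [|z [[]|[]]] //; left.
have dd_neq x y : x <> y -> dd x y = rmax (rho x) (rho y).
  by move=> H; apply: the_eq => [|z [[]|[]]] //; right.
clearbody dd.
have dd_in x y : x ∈ X -> y ∈ X -> dd x y ∈ C.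
  by move=> Hx Hy; case: (classic (x = y)) => [->|/dd_neq ->]; rewrite ?dd_refl; auto.
have [d [Hd Ed]] := @fun2_exists _ _ X X C dd _ dd_in.
have rel2_d x y r : rel2 d x y r <-> x ∈ X /\ y ∈ X /\ r = dd x y.
  rewrite (rel2_fun _ _ _ Hd); split=> -[Hx [Hy ->]]; rewrite Ed; auto.
have dd_nonneg x y : x ∈ X -> y ∈ X -> 0 ≤ dd x y.
  move=> Hx Hy; case: (classic (x = y)) => [->|/dd_neq ->].
    by rewrite dd_refl; apply: le_refl; auto.
  have [H _] := rmax_spec (rho_in Hx) (rho_in Hy); apply: (le_trans (y := rho x)); auto.
have dd_sym x y : x ∈ X -> y ∈ X -> dd x y = dd y x.
  move=> Hx Hy; case: (classic (x = y)) => [->|Hn] //.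
  rewrite !dd_neq; auto.
  have [H1 [H2 H3]] := rmax_spec (rho_in Hx) (rho_in Hy).
  have [H4 [H5 H6]] := rmax_spec (rho_in Hy) (rho_in Hx).
  apply: le_antisym; auto.
    by case: H3 => ->.
  by case: H6 => ->.
exists d; split; last by move=> x y Hx Hy Hn; rewrite Ed // dd_neq.
split; first by [].
split; first by move=> x y r; rewrite rel2_d => -[Hx [Hy ->]]; auto.
split.
{ move=> x y Hx Hy; rewrite rel2_d; split=> [[_ [_]]|->]; last by rewrite dd_refl.
  case: (classic (x = y)) => // Hn; rewrite dd_neq // => E.
  have [H1 [H2 _]] := rmax_spec (rho_in Hx) (rho_in Hy); rewrite -E in H1 H2.
  by apply: rho_inj0 => //; apply: le_antisym; auto. }
split.
{ by move=> x y r; rewrite !rel2_d => -[Hx [Hy ->]]; rewrite dd_sym. }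
move=> x y z a b c s; rewrite !rel2_d rel2_add.
move=> [Hx [Hy ->]] [_ [Hz ->]] [_ [_ ->]] [_ [_ ->]].
case: (classic (x = y)) => [->|Hxy].
  by rewrite dd_refl addC ?add0; auto; apply: le_refl; auto.
case: (classic (y = z)) => [->|Hyz].
  by rewrite dd_refl add0; auto; apply: le_refl; auto.
case: (classic (x = z)) => [->|Hxz].
  rewrite dd_refl; apply: (le_trans (y := dd z y)); auto.
  by apply: le_add_nonneg; auto.
(* For three distinct points, the maximum of [rho x] and [rho z] is one of the two, and is thus
   bounded by a single summand: [dd x y] or [dd y z]. *)
have [_ [_ H]] := rmax_spec (rho_in Hx) (rho_in Hz).
have [H1 _] := rmax_spec (rho_in Hx) (rho_in Hy).
have [_ [H2 _]] := rmax_spec (rho_in Hy) (rho_in Hz).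
rewrite -dd_neq // in H1; rewrite -dd_neq // in H2.
rewrite dd_neq //; case: H => ->.
  apply: (le_trans (y := dd x y)); auto.
  by apply: le_add_nonneg; auto.
apply: (le_trans (y := dd y z)); auto.
by rewrite addC; auto; apply: le_add_nonneg; auto.
Qed.

Variables (d T : V).
Hypothesis Hd : metric R X d.
Hypothesis HdX : null_dist d.
Hypothesis HT : metric_topology R X d T.

Notation dist := (app2 d).
Let dist_inX x y : x ∈ X -> y ∈ X -> dist x y ∈ C := fun hx hy => dist_in Hd hx hy.
Local Hint Resolve dist_inX : core.

Lemma null_dist_ge x y : x ∈ X -> y ∈ X -> dist x y ≺ rho x -> y = x.
Proof.
move=> Hx Hy H; apply: NNPP => Hn; have [Hle _] := rmax_spec (rho_in Hx) (rho_in Hy).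
have: ~ rmax (rho x) (rho y) ≺ rho x by apply/not_lt; auto.
by rewrite -HdX; auto.
Qed.

Lemma null_dist_lt x y e : positive R e -> x ∈ X -> y ∈ X ->
  rho x ≺ e -> rho y ≺ e -> dist x y ≺ e.
Proof.
move=> [_ He] Hx Hy Hxe Hye; case: (classic (x = y)) => [<-|Hn].
  by rewrite (dist_refl Hd).
by rewrite HdX //; case: (rmax_spec (rho_in Hx) (rho_in Hy)) => _ [_ [->|->]].
Qed.

Lemma null_singleton_open x : x ∈ X -> rho x <> 0 -> sing x ∈ T.
Proof.
move=> Hx Hn; have -> : sing x = ball X d x (rho x).
  apply: ext_eq => y; rewrite in_sing in_ball; split=> [->|[Hy]].
    by rewrite (dist_refl Hd) //; split=> //; split; auto.
  exact: null_dist_ge.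
by apply/(proj1 (metric_topologyP Hd T) HT); apply: (open_ball Hd); auto.
Qed.

Lemma null_scattered : scattered X T.
Proof.
have [_ [XT _]] := metric_topology_topology Hd HT.
move=> S HS [x Hx]; case: (classic (exists y, y ∈ S /\ rho y <> 0)) => [[y [Hy Hn]]|H].
  exists y; split=> //; exists (sing y); split; first by apply: null_singleton_open; auto.
  by move=> z; rewrite in_sing; split=> [[]|->].
(* In the remaining case [rho] vanishes on [S], so [S] is a single point, isolated by the open set
   [X]. *)
have H0 z : z ∈ S -> rho z = 0.
  by move=> Hz; apply: NNPP => Hn; apply: H; exists z.
exists x; split=> //; exists X; split=> // z; split=> [[_ Hz]|->]; auto.
Qed.

Hypothesis rho_null : forall e, positive R e -> finite (sep X (fun x => ~ rho x ≺ e)).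

(** A finite net consists of the finitely many points with [rho] at least [e] and one point [o] with
    [rho] below [e], if any; [o] is closer than [e] to all other points of that kind. *)
Lemma null_totally_bounded : totally_bounded R X d.
Proof.
apply/(totally_boundedP Hd) => e He; pose (K := sep X (fun x => ~ rho x ≺ e)).
have in_K x : x ∈ K <-> x ∈ X /\ ~ rho x ≺ e by rewrite in_sep.
have FK : finite K by exact: rho_null.
have HK x : x ∈ K -> exists y, y ∈ K /\ dist y x ≺ e.
  move=> Hx; exists x; split=> //; case/in_K: Hx => Hx _.
  by rewrite (dist_refl Hd) //; case: He.
case: (classic (exists o, o ∈ X /\ rho o ≺ e)) => [[o [Ho Hoe]]|Hno]; last first.
  exists K; split; first by move=> x /in_K [].
  by split=> // y Hy; apply: HK; rewrite in_K; split=> // H; apply: Hno; exists y.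
exists (adj K o); split; first by move=> x; rewrite in_adj in_K => -[[]|->].
split; first exact: finite_adj.
move=> y Hy; case: (classic (y ∈ K)) => [/HK [x [Hx Hxy]]|H].
  by exists x; rewrite in_adj; auto.
exists o; rewrite in_adj; split; auto; apply: null_dist_lt => //.
by apply: NNPP => H'; apply: H; rewrite in_K.
Qed.

(** A member of the cover around the zero [o] of [rho] contains a ball, hence all but finitely many
    points; finitely many further members take care of these. *)
Lemma null_compact o : o ∈ X -> rho o = 0 -> compact X T.
Proof.
move=> Ho Eo K [HKT HKX]; have [U [HU HoU]] := HKX o Ho.
have [HUX /(_ o HoU) [n [Hn Hb]]] := proj1 (proj1 (metric_topologyP Hd T) HT U) (HKT U HU).
pose proof (pow2_positive Hn) as Hpos.
have [|D [FD [HDK HD]]] := @finite_selection _ _ (fun x W => x ∈ W) _ K _ (rho_null Hpos).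
  by move=> x; rewrite in_sep => -[/HKX].
exists (adj D U); split; first by move=> W; rewrite in_adj => -[/HDK|->].
split; first exact: finite_adj.
split; first by move=> W; rewrite in_adj => -[/HDK /HKT|->]; auto.
move=> x Hx; case: (classic (rho x ≺ pow2 n)) => H.
  exists U; rewrite in_adj; split; auto; apply: Hb; rewrite in_ball; split=> //.
  by apply: null_dist_lt => //; rewrite Eo; case: Hpos.
have [|W [HW HxW]] := HD x; first by rewrite in_sep.
by exists W; rewrite in_adj; auto.
Qed.

(** If [rho] stayed at least [e] along the sequence, terms closer than [e] would coincide; a Cauchy
    sequence would be constant from some stage on, and converge. *)
Lemma null_divergent s : is_seq X s -> cauchy R d s -> ~ (exists l, l ∈ X /\ converges R d s l) ->
  forall e, positive R e -> exists m, m ∈ omega /\ app s m ∈ X /\ rho (app s m) ≺ e.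
Proof.
move=> [w [/is_omega_omega -> Hs]] Hc Hnl e He; apply: NNPP => Hno; apply: Hnl.
have sX n : n ∈ omega -> app s n ∈ X by exact: (app_in Hs).
have HeC : e ∈ C by case: He.
have [N [/in_omega HN HcN]] := Hc e He.
exists (app s N); split; auto => e' He'; exists N; split; first by apply/in_omega.
move=> n x Hn /(rel_fun _ _ Hs) [Hno' ->]; rewrite (closerE Hd); split; [|split]; auto.
have: closer R d (app s N) (app s n) e.
  by apply: (HcN N n) => //; [right|apply: (rel_app Hs)|apply: (rel_app Hs)].
rewrite (closerE Hd) => -[_ [_ H]].
have -> : app s n = app s N.
  apply: null_dist_ge; auto; apply: (lt_le_trans (y := e)); auto.
  by apply/not_lt; auto; move=> H'; apply: Hno; exists N; auto.
by rewrite (dist_refl Hd); auto; case: He'.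
Qed.

End NullSpace.

(** * Finite partial choice functions *)

Section PartialChoice.

Variables (A f : V).
Hypothesis Hf : is_bijection f omega A.
Hypothesis HA : forall x, x ∈ A -> nonempty x /\ finite x.

Definition partial_choices : V :=
  sep (pow (cprod omega (union A))) (fun g => exists n, n ∈ omega /\
    is_fun g n (union A) /\ forall k, k ∈ n -> app g k ∈ app f k).

Definition len (g : V) : V := the (fun n => is_fun g n (union A)).
#[export] Instance F1_len : F1 len.
Proof. unfold len; dfn_class. Qed.

Notation Z := partial_choices.

Lemma len_eq g n : is_fun g n (union A) -> len g = n.
Proof. by move=> H; apply: the_eq => // m H'; apply: (fun_dom H' H). Qed.

Lemma f_in k : k ∈ omega -> app f k ∈ A.
Proof. by case/bijection_app: Hf => H _; apply: (app_in H). Qed.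

Lemma partial_choices_spec g : g ∈ Z -> len g ∈ omega /\
  is_fun g (len g) (union A) /\ forall k, k ∈ len g -> app g k ∈ app f k.
Proof. by rewrite in_sep => -[_ [n [Hn [Hg Hk]]]]; rewrite (len_eq Hg). Qed.

Lemma partial_choices_intro g n : n ∈ omega -> is_fun g n (union A) ->
  (forall k, k ∈ n -> app g k ∈ app f k) -> g ∈ Z.
Proof.
move=> Hn Hg Hk; rewrite in_sep; split; last by exists n.
rewrite in_pow => p /(in_fun Hg) [k [Hkn ->]]; rewrite pr_in_cprod.
by split; [apply: (nat_in_omega Hn Hkn)|apply: (app_in Hg)].
Qed.

Lemma partial_choices_long : forall n, n ∈ omega -> exists g, g ∈ Z /\ len g = n.
Proof.
apply: omega_ind.
  have H : is_fun emp emp (union A).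
    by apply: fun_intro; [move=> p /in_emp|move=> a /in_emp|move=> a b c /rel_pr /in_emp].
  exists emp; rewrite (len_eq H); split=> //.
  by apply: (partial_choices_intro emp_omega H) => k /in_emp.
move=> n Hn [g [Hg Eg]]; have [_ [Hfun Hk]] := partial_choices_spec Hg; rewrite Eg in Hfun Hk.
have [[y Hy] _] := HA (f_in Hn).
pose (G := fun k => the (fun b => k ∈ n /\ b = app g k \/ ~ k ∈ n /\ b = y)).
have F_G : F1 G by rewrite /G; exact _.
have G1 k : k ∈ n -> G k = app g k.
  by move=> Hkn; apply: the_eq => [|z [[]|[]]] //; left.
have G2 : G n = y.
  apply: the_eq => [|z [[/mem_irrefl]|[]]] //; right; split=> //; exact: mem_irrefl.
have Gf k : k ∈ suc n -> G k ∈ app f k.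
  by rewrite in_suc => -[Hkn|->]; [rewrite G1 //; apply: Hk|rewrite G2].
have GU k : k ∈ suc n -> G k ∈ union A.
  move=> Hkn; rewrite in_union; exists (app f k); split; last exact: Gf.
  by apply: f_in; apply: (nat_in_omega (suc_omega Hn) Hkn).
pose proof (lam_fun GU) as Hl.
exists (lam (suc n) (union A) G); rewrite (len_eq Hl); split=> //.
apply: (partial_choices_intro (suc_omega Hn) Hl) => k Hkn.
by rewrite app_lam //; apply: Gf.
Qed.

(** The first [N] members of the family are finite sets, so their union is contained in a finite
    [W], and all these partial choices are subsets of [cprod N W]. *)
Lemma short_partial_choices_finite N : N ∈ omega -> finite (sep Z (fun g => len g ∈ N)).
Proof.
move=> HN.
have [k Hk|W [FW HW]] := @finite_bigcup _ _ (fun k y => y ∈ app f k) _ _ (nat_finite HN).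
  exists (app f k); split=> //.
  by have [] := HA (f_in (nat_in_omega HN Hk)).
apply: (finite_subset (finite_pow (finite_cprod (nat_finite HN) FW))) => g.
rewrite in_sep in_pow => -[/partial_choices_spec [_ [Hg Hgk]] HgN] p /(in_fun Hg) [k [Hk ->]].
pose proof (nat_lt_trans HN Hk HgN) as HkN.
by rewrite pr_in_cprod; split=> //; apply: (HW k) => //; apply: Hgk.
Qed.

(* An enumeration of arbitrarily long partial choices yields a choice from each
   member of the family: take the first listed one which is long enough. *)
Lemma choice_of_long_partial_choices e :
  (forall k, k ∈ omega -> exists m, m ∈ omega /\ (app e m ∈ Z /\ k ∈ len (app e m))) ->
  exists c, choice_function c A.
Proof.
move=> He; have [_ [_ Hsur]] := bijection_app Hf.
pose (idx := fun a => least omega (fun k => app f k = a)).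
have F_idx : F1 idx by rewrite /idx; exact _.
have idx_spec a : a ∈ A -> idx a ∈ omega /\ app f (idx a) = a.
  by move=> /Hsur /least_spec [H1 [H2 _]].
pose (first := fun k => least omega (fun m => app e m ∈ Z /\ k ∈ len (app e m))).
have F_first : F1 first by rewrite /first; exact _.
have first_spec k : k ∈ omega -> app e (first k) ∈ Z /\ k ∈ len (app e (first k)).
  by move=> /He /least_spec [_ [H _]].
pose (F := fun a => app (app e (first (idx a))) (idx a)).
have F_F : F1 F by rewrite /F; exact _.
have HF a : a ∈ A -> F a ∈ a.
  move=> /idx_spec [Hi Ea]; have [HZ Hlen] := first_spec _ Hi.
  have [_ [_ H]] := partial_choices_spec HZ; rewrite -{2}Ea; exact: H.
have HFU a : a ∈ A -> F a ∈ union A by move=> Ha; rewrite in_union; exists a; auto.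
exists (lam A (union A) F), (union A); split; first by apply/is_union_union.
split; first exact: lam_fun.
by move=> x y; rewrite rel_lam => -[Hx [_ ->]]; apply: HF.
Qed.

Lemma pow2_lt_inv m n : m ∈ omega -> n ∈ omega -> pow2 m ≺ pow2 n -> n ∈ m.
Proof.
move=> Hm Hn H; case: (nat_trichotomy Hm Hn) => [//|[E|H']].
  by case: (lt_irrefl (x := pow2 n)); rewrite {1}E.
case: (lt_irrefl (x := pow2 n)); apply: (lt_trans (y := pow2 m)); auto.
exact: pow2_decreasing.
Qed.

Lemma wide_partial_choices_finite e : positive R e ->
  finite (sep Z (fun g => ~ pow2 (len g) ≺ e)).
Proof.
move=> He; have HeC : e ∈ C by case: He.
have [N [HN HNe]] := pow2_small He.
(* With 2^(-N) below [e], a length exceeding [N] is excluded; the lengths left are at most [N], that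
   is, below [suc N]. *)
apply: (finite_subset (short_partial_choices_finite (suc_omega HN))) => g.
rewrite !(in_sep Z) => -[Hg H]; split=> //; have [Hl _] := partial_choices_spec Hg.
apply: nat_not_lt => // H'; apply: H; apply: (lt_trans (y := pow2 N)); auto.
exact: pow2_decreasing.
Qed.

Lemma choice_of_compact_countable :
  (forall X T, topology X T -> compact X T -> metrizable R X T -> scattered X T ->
    countable X) -> exists c, choice_function c A.
Proof.
(* The set [Z] itself serves as the point at infinity; it is not one of its own elements by
   foundation. *)
move=> H3; pose (Y := adj Z Z).
pose (rho := fun x => the (fun r => x = Z /\ r = 0 \/ x <> Z /\ r = pow2 (len x))).
have F_rho : F1 rho by rewrite /rho; exact _.
have rhoZ : rho Z = 0 by apply: the_eq => [|z [[]|[]]] //; left.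
have rho_g g : g ∈ Z -> rho g = pow2 (len g).
  move=> Hg; have Hn : g <> Z by move=> E; apply: (@mem_irrefl _ _ Z); rewrite -{1}E.
  by apply: the_eq => [|z [[]|[]]] //; right.
have len_nat g : g ∈ Z -> len g ∈ omega by move=> /partial_choices_spec [].
have rho_pos g : g ∈ Z -> positive R (rho g).
  by move=> Hg; rewrite rho_g //; apply: pow2_positive; auto.
have ZY : Z ∈ Y by rewrite in_adj; right.
have rho_in x : x ∈ Y -> rho x ∈ C.
  by rewrite in_adj => -[/rho_pos []|->] //; rewrite rhoZ; exact: zero_in.
have rho_nonneg x : x ∈ Y -> 0 ≤ rho x.
  rewrite in_adj => -[/rho_pos [_ /lt_le]|->] //; rewrite rhoZ.
  by apply: le_refl; exact: zero_in.
have rho0 x : x ∈ Y -> rho x = 0 -> x = Z.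
  by rewrite in_adj => -[/rho_pos [_ [_ H]]|->] // E; case: H.
have rho_inj0 x y : x ∈ Y -> y ∈ Y -> rho x = 0 -> rho y = 0 -> x = y.
  by move=> Hx Hy /(rho0 _ Hx) -> /(rho0 _ Hy) ->.
have rho_null e : positive R e -> finite (sep Y (fun x => ~ rho x ≺ e)).
  move=> He; apply: (finite_subset (wide_partial_choices_finite He)) => x.
  rewrite (in_sep Y) (in_sep Z) in_adj => -[[Hx|->]]; first by rewrite rho_g.
  by rewrite rhoZ; case: He => _ H; case.
have [d [Hd HdY]] := null_metric_exists rho_in rho_nonneg rho_inj0.
have [T HT] := metric_topology_exists Hd.
have [|||en Hen] := countable_enumeration (H3 Y T (metric_topology_topology Hd HT) _ _ _).
{ exact: (null_compact rho_in Hd HdY HT rho_null ZY rhoZ). }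
{ by exists d. }
{ exact: (null_scattered rho_in rho_nonneg rho_inj0 Hd HdY HT). }
apply: (@choice_of_long_partial_choices en) => k Hk.
(* A partial choice must have length k+1 in order to be defined at [k]. *)
have [g [Hg Eg]] := partial_choices_long (suc_omega Hk).
have [|m [Hm E]] := Hen g; first by rewrite in_adj; left.
by exists m; rewrite E Eg in_suc; auto.
Qed.

Lemma choice_of_complete_compact :
  (forall X d T, metric R X d -> metric_topology R X d T ->
    totally_bounded R X d -> complete R X d -> scattered X T -> compact X T) ->
  exists c, choice_function c A.
Proof.
move=> H4; apply: NNPP => Hno; pose (rho := fun g => pow2 (len g)).
have F_rho : F1 rho by rewrite /rho; exact _.
have len_nat g : g ∈ Z -> len g ∈ omega by move=> /partial_choices_spec [].
have rho_pos g : g ∈ Z -> positive R (rho g).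
  by move=> Hg; apply: pow2_positive; auto.
have rho_in x : x ∈ Z -> rho x ∈ C by move=> /rho_pos [].
have rho_nonneg x : x ∈ Z -> 0 ≤ rho x by move=> /rho_pos [_ /lt_le].
have rho_n0 x : x ∈ Z -> rho x <> 0 by move=> /rho_pos [_ [_ H]] E; case: H.
have rho_inj0 x y : x ∈ Z -> y ∈ Z -> rho x = 0 -> rho y = 0 -> x = y.
  by move=> /rho_n0.
have rho_null e : positive R e -> finite (sep Z (fun x => ~ rho x ≺ e)).
  exact: wide_partial_choices_finite.
have [d [Hd HdZ]] := null_metric_exists rho_in rho_nonneg rho_inj0.
have [T HT] := metric_topology_exists Hd.
(* A Cauchy sequence without limit contains arbitrarily long partial choices and so yields a choice
   function. As none is assumed to exist, [Z] is complete. *)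
have Hcomp : complete R Z d.
  move=> s Hs Hc; apply: NNPP => Hnl; apply: Hno.
  apply: (@choice_of_long_partial_choices s) => k Hk.
  have [m [Hm [HmZ Hlt]]] := null_divergent rho_in Hd HdZ Hs Hc Hnl (pow2_positive Hk).
  by exists m; split=> //; split=> //; apply: pow2_lt_inv; auto.
have Hcpt : compact Z T.
  apply: (H4 Z d T Hd HT) => //; first exact: (null_totally_bounded rho_in Hd HdZ rho_null).
  exact: (null_scattered rho_in rho_nonneg rho_inj0 Hd HdZ HT).
(* By compactness, finitely many open singletons cover [Z], which leaves finitely many lengths,
   although every number is a length. *)
have [|D [HDK [FD [_ Hcov]]]] := Hcpt (sep T (fun S => exists x, x ∈ Z /\ S = sing x)).
  split; first by move=> S; rewrite in_sep => -[].
  move=> x Hx; exists (sing x); rewrite in_sep in_sing; split=> //; split; last by exists x.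
  by apply: (null_singleton_open rho_in rho_nonneg Hd HdZ HT); auto.
(* The union of a singleton is its point, so [len (union S)] is the length of the partial choice in
   [S]. *)
have [L [FL HL]] := @finite_image _ _ (fun S => len (union S)) _ D FD.
have omega_L : subset omega L.
  move=> n /partial_choices_long [g [Hg <-]]; have [S [HS HgS]] := Hcov g Hg.
  have: len (union S) ∈ L by exact: HL.
  case/in_sep: (HDK S HS) => _ [x [Hx E]]; move: HgS; rewrite E in_sing => <-.
  have -> : union (sing g) = g; last by [].
  apply: ext_eq => y; rewrite in_union; split=> [[z [/in_sing ->]] //|Hy].
  by exists g; rewrite in_sing.
(* A finite [omega] would have a greatest element. *)
have [|||m [Hm Hmax]] := @finite_max _ _ (fun x y => x ∈ y) _ omega (finite_subset FL omega_L).
{ by exists emp; exact: emp_omega. }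
{ by move=> x y z _ _ Hz; apply: nat_lt_trans. }
{ by move=> x y Hx Hy; case: (nat_trichotomy Hy Hx) => [|[|]]; auto. }
have Hin : m ∈ suc m by rewrite in_suc; right.
case: (Hmax (suc m) (suc_omega Hm)) => [E|H]; first by apply: (@mem_irrefl _ _ m); rewrite -{2}E.
exact: nat_lt_asym Hm Hin H.
Qed.

End PartialChoice.

End Analysis.

(** The cycles (i) ⇒ (ii) ⇒ (iii) ⇒ (i) and (i) ⇒ (iv) ⇒ (i) give all the equivalences. For (ii) ⇒
    (iii), any metric inducing a compact topology is totally bounded. *)
Theorem theorem4p4 (V : membership_structure) (HV : ZF V)
    (R : field_structure V) (HR : is_real_field R) :
  let i := CAC_fin V in
  let ii := forall X d T : V, metric R X d -> metric_topology R X d T ->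
    totally_bounded R X d -> scattered X T -> countable X in
  let iii := forall X T : V, topology X T -> compact X T ->
    metrizable R X T -> scattered X T -> countable X in
  let iv := forall X d T : V, metric R X d -> metric_topology R X d T ->
    totally_bounded R X d -> complete R X d -> scattered X T -> compact X T in
  (i <-> ii) /\ (i <-> iii) /\ (i <-> iv).
Proof.
move=> i ii iii iv.
have i_ii : i -> ii.
  by move=> AC X d T Hd HT Htb Hsc; exact: (scattered_countable Hd AC HT Htb Hsc).
have ii_iii : ii -> iii.
  move=> H2 X T _ Hcpt [d [Hd HT]] Hsc.
  by apply: (H2 X d T) => //; exact: (compact_totally_bounded Hd HT Hcpt).
have iii_i : iii -> i.
  move=> H3 A [w [f [/is_omega_omega -> Hf]]] HA.
  exact: (choice_of_compact_countable Hf HA H3).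
have i_iv : i -> iv.
  move=> AC X d T Hd HT Htb Hcomp Hsc.
  apply: (complete_countable_compact Hd HT Htb Hcomp).
  exact: (i_ii AC X d T).
have iv_i : iv -> i.
  move=> H4 A [w [f [/is_omega_omega -> Hf]]] HA.
  exact: (choice_of_complete_compact Hf HA H4).
by tauto.
Qed.
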